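(* Consider the learning protocol described in the context. Suppose the stepsize sequence $\Delta(t)$ is nonnegative, nonincreasing, and satisfies \[ \sum_{t=1}^{\infty} \Delta(t) = +\infty, \qquad \sum_{t=1}^{\infty} \Delta^2(t) < \infty, \qquad \sup_{t \geq 1} \frac{\Delta(t)}{\Delta(t+c)} < \infty \ \text{ for every fixed integer } c\ge 0 . \] Then for any initial values $v_1(0), \ldots, v_n(0)\in\mathbb{R}^l$, with probability $1$, \[ \lim_{t \rightarrow \infty} v_i(t) = \mu \quad \text{ for all } i=1,\dots,n. \]
   Context: Model. There are $n$ nodes $\{1,\dots,n\}$ and an unknown fixed vector $\mu\in\mathbb{R}^l$. At each time $t=0,1,2,\dots$ there is a given (deterministic) undirected graph $G(t)=(\{1,\dots,n\},E(t))$ without self-loops. $N_i(t)$ is the set of neighbors of $i$ in $G(t)$ and $d_i(t)=|N_i(t)|$. The sequence is $B$-connected for some positive integer $B$: for each integer $k\ge 0$ the graph $(\{1,\dots,n\},\bigcup_{t=kB+1}^{(k+1)B}E(t))$ is connected. At each time $t$ a given (deterministic, possibly empty) set $S(t)\subseteq\{1,\dots,n\}$ of nodes has a measurement $\mu_i(t)=\mu+w_i(t)$, $i\in S(t)$. The measurement times (times $t$ with $S(t)\neq\emptyset$), listed in increasing order as $t_1<t_2<\cdots$, form an infinite sequence with $t_1=1$ and $|t_{k+1}-t_k|<T$ for all $k\ge1$, where $T$ is a positive integer. Each node $i$ keeps an estimate $v_i(t)\in\mathbb{R}^l$, and for each neighbor $j\in N_i(t)$ observes $o_{ij}(t)=v_j(t)-v_i(t)+w_{ij}(t)$.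 The noises $w_i(t)$, $w_{ij}(t)$ (the latter indexed by ordered pairs) are zero-mean random vectors in $\mathbb{R}^l$, every entry of $w_i(t)$ having variance $\sigma^2$ and every entry of $w_{ij}(t)$ having variance $(\sigma')^2$; all these random vectors are independent of each other. Protocol with stepsizes $\Delta(t)$: if $i\notin S(t)$, \[ v_i(t+1)=v_i(t)+\frac{\Delta(t)}{4}\sum_{j\in N_i(t)}\frac{o_{ij}(t)}{\max(d_i(t),d_j(t))}, \] and if $i\in S(t)$, \[ v_i(t+1)=v_i(t)+\frac{\Delta(t)}{4}\left(\mu_i(t)-v_i(t)\right)+\frac{\Delta(t)}{4}\sum_{j\in N_i(t)}\frac{o_{ij}(t)}{\max(d_i(t),d_j(t))}. \] *)

(* Defs.v *)
From HB Require Import structures.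
From mathcomp Require Import all_boot all_order all_algebra.
From mathcomp Require Import finmap.
From mathcomp Require Import all_classical all_reals all_analysis.

Set Implicit Arguments.
Unset Strict Implicit.
Unset Printing Implicit Defensive.

Import Order.TTheory GRing.Theory Num.Theory.
Import numFieldNormedType.Exports.

Local Open Scope classical_set_scope.
Local Open Scope ring_scope.

Definition simple_graph (n : nat) (e : rel 'I_n) : Prop :=
  symmetric e /\ irreflexive e.

Definition connected_graph (n : nat) (e : rel 'I_n) : Prop :=
  forall i j : 'I_n, connect e i j.

Definition neighbors (n : nat) (e : rel 'I_n) (i : 'I_n) : {set 'I_n} :=
  [set j : 'I_n | e i j]%SET.

Definition degree (n : nat) (e : rel 'I_n) (i : 'I_n) : nat :=
  #|neighbors e i|.

(* The union of the edge sets [E t] over the times [a <= t < b]. *)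
Definition union_graph (n : nat) (E : nat -> rel 'I_n) (a b : nat) :
    rel 'I_n :=
  fun i j => has (fun t => E t i j) (index_iota a b).

(* The k-th window is kB + 1, ..., (k + 1)B; [index_iota] excludes its upper
   end. *)
Definition B_connected (n : nat) (B : nat) (E : nat -> rel 'I_n) : Prop :=
  forall k : nat,
    connected_graph (union_graph E (k * B).+1 (k.+1 * B).+1).

(* [tau] enumerates from index 0, so that [tau k] is the (k + 1)-st
   measurement time. *)
Definition measurement_times (n : nat) (S : nat -> {set 'I_n})
    (tau : nat -> nat) : Prop :=
  {homo tau : k m / (k < m)%N} /\
  (forall t : nat, S t != finset.set0 <-> exists k : nat, tau k = t).

(* R^l with its Borel sigma-algebra. *)
Definition borel_rV (R : realType) (l : nat) :=
  g_sigma_algebraType [set A : set 'rV[R]_l | open A].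

Definition random_vector (R : realType) (l : nat) (d : measure_display)
    (Omega : measurableType d) (X : Omega -> 'rV[R]_l) : Prop :=
  measurable_fun [set: Omega] (X : Omega -> borel_rV R l).

(* Integrability is stated because the expectation of a non-integrable
   function is a conventional value. The entries of one vector may be
   correlated. *)
Definition zero_mean_with_variance (R : realType) (l : nat)
    (d : measure_display) (Omega : measurableType d) (P : probability Omega R)
    (X : Omega -> 'rV[R]_l) (s2 : R) : Prop :=
  forall k : 'I_l,
    let Xk := fun omega => X omega ord0 k in
    [/\ P.-integrable [set: Omega] (EFin \o Xk),
        ('E_P[Xk] = 0)%E & ('V_P[Xk] = s2%:E)%E].

Definition mutually_independent (R : realType) (l : nat)
    (d : measure_display) (Omega : measurableType d) (P : probability Omega R)
    (I : choiceType) (D : set I) (X : I -> Omega -> 'rV[R]_l) : Prop :=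
  forall J : {fset I}, [set` J] `<=` D ->
  forall A : I -> set (borel_rV R l), (forall j, j \in J -> measurable (A j)) ->
    (P (\bigcap_(j in [set` J]) (X j @^-1` A j)) =
     \prod_(j <- J) P (X j @^-1` A j))%E.

(* [inl (t, i)] indexes the noise w_i(t) of a measurement and
   [inr (t, i, j)] the noise w_ij(t) of an observation of j by i. *)
Definition noise_index (n : nat) : choiceType :=
  ((nat * 'I_n) + (nat * 'I_n * 'I_n))%type.

(* The noises which occur in the model: w_i(t) for i in S(t), and w_ij(t) for
   j a neighbor of i in G(t), indexed by ordered pairs. *)
Definition active_noise (n : nat) (E : nat -> rel 'I_n)
    (S : nat -> {set 'I_n}) : set (noise_index n) :=
  [set x | match x with
           | inl (t, i) => i \in S t
           | inr (t, i, j) => j \in neighbors (E t) i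
           end].

Definition noise (n : nat) (V : Type) (wm : nat -> 'I_n -> V)
    (wo : nat -> 'I_n -> 'I_n -> V) (x : noise_index n) : V :=
  match x with
  | inl (t, i) => wm t i
  | inr (t, i, j) => wo t i j
  end.

Definition noise_model (R : realType) (n l : nat) (d : measure_display)
    (Omega : measurableType d) (P : probability Omega R)
    (E : nat -> rel 'I_n) (S : nat -> {set 'I_n}) (sigma sigma' : R)
    (wm : nat -> 'I_n -> Omega -> 'rV[R]_l)
    (wo : nat -> 'I_n -> 'I_n -> Omega -> 'rV[R]_l) : Prop :=
  [/\ forall x, active_noise E S x -> random_vector (noise wm wo x),
      forall t i, i \in S t ->
        zero_mean_with_variance P (wm t i) (sigma ^+ 2),
      forall t i j, j \in neighbors (E t) i ->
        zero_mean_with_variance P (wo t i j) (sigma' ^+ 2)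
    & mutually_independent P (active_noise E S) (noise wm wo)].

Section protocol.
Variables (R : realType) (n l : nat) (Omega : Type).
Variables (mu : 'rV[R]_l) (E : nat -> rel 'I_n) (S : nat -> {set 'I_n}).
Variables (Delta : nat -> R).
Variables (wm : nat -> 'I_n -> Omega -> 'rV[R]_l).
Variables (wo : nat -> 'I_n -> 'I_n -> Omega -> 'rV[R]_l).
Variables (v0 : 'I_n -> 'rV[R]_l) (v : nat -> 'I_n -> Omega -> 'rV[R]_l).

Definition measurement (t : nat) (i : 'I_n) (omega : Omega) : 'rV[R]_l :=
  mu + wm t i omega.

Definition observation (t : nat) (i j : 'I_n) (omega : Omega) : 'rV[R]_l :=
  v t j omega - v t i omega + wo t i j omega.

Definition consensus_term (t : nat) (i : 'I_n) (omega : Omega) : 'rV[R]_l :=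
  \sum_(j in neighbors (E t) i)
    (maxn (degree (E t) i) (degree (E t) j))%:R^-1 *: observation t i j omega.

Definition learning_protocol : Prop :=
  [/\ forall i omega, v 0%N i omega = v0 i,
      forall t i omega, i \notin S t ->
        v t.+1 i omega =
          v t i omega + (Delta t / 4) *: consensus_term t i omega
    & forall t i omega, i \in S t ->
        v t.+1 i omega =
          v t i omega
          + (Delta t / 4) *: (measurement t i omega - v t i omega)
          + (Delta t / 4) *: consensus_term t i omega].

End protocol.

(* Main.v *)
(** Writing x = v - mu, each coordinate obeys the linear recursion
    x(t+1) = x(t) - h(t) M(t) x(t) + e(t), where h = Delta / 4 and M(t) is the
    Laplacian of G(t) with Metropolis weights plus the indicator of S(t).  The
    noise e(t) does not depend on the state, so probability enters only through
    the almost sure convergence of the series of e(t): it is a sum of weighted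
    series of independent centered variables with summable variances
    (Kolmogorov's one-series theorem).

    On that event the argument is deterministic.  Adding to x(t) the tail
    of the noise series turns the noise into h(t) times a null sequence.  Over a
    window of B * T steps the union graph is connected and some node is measured,
    so the Dirichlet energies of a fixed vector over the window dominate its
    squared norm; since the iterate moves only by O(h) within a window, the
    squared norm V satisfies V' <= (1 - c h) V + h o(1), whence V -> 0 because
    h is not summable. *)

Require Import Defs.
From HB Require Import structures.
From mathcomp Require Import all_boot all_order all_algebra.
From mathcomp Require Import finmap.
From mathcomp Require Import all_classical all_reals all_analysis.
From mathcomp Require Import measurable_realfun.
From mathcomp Require Import ring lra.

Set Implicit Arguments.
Unset Strict Implicit.
Unset Printing Implicit Defensive.

Import Order.TTheory GRing.Theory Num.Theory.
Import numFieldNormedType.Exports.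

Local Open Scope classical_set_scope.
Local Open Scope ring_scope.

(** * Dirichlet energy of a pinned weighted graph *)

Section diffusion.
Context (R : rcfType) (n : nat).
Implicit Types (s y z : 'I_n -> R) (m : 'I_n -> 'I_n -> R).

(** The operator [diag s + L], with [L] the Laplacian of the weights [m]. The pin [s i] pulls a
    coordinate towards 0, as a measurement does to the error [v - mu]. *)
Definition diffusion s m y i := s i * y i + \sum_j m i j * (y i - y j).

Definition energy s m y := \sum_i y i * diffusion s m y i.

(** The unit bounds control the operator in the sup norm; symmetry makes its quadratic form a sum of
    squares. *)
Definition diffusive s m :=
  [/\ forall i, 0 <= s i <= 1, forall i j, 0 <= m i j,
      forall i j, m i j = m j i & forall i, \sum_j m i j <= 1].

Lemma diffusionD s m y z i :
  diffusion s m (fun j => y j + z j) i = diffusion s m y i + diffusion s m z i.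
Proof.
rewrite /diffusion mulrDr addrACA -big_split/=; congr (_ + _).
by apply: eq_bigr => j _; ring.
Qed.

Lemma diffusionN s m y i :
  diffusion s m (fun j => - y j) i = - diffusion s m y i.
Proof.
rewrite /diffusion mulrN opprD -sumrN; congr (_ + _).
by apply: eq_bigr => j _; ring.
Qed.

Lemma diffusion_bound s m y b i : diffusive s m ->
  (forall j, `|y j| <= b) -> `|diffusion s m y i| <= 3 * b.
Proof.
move=> [s01 m0 _ m1] yb.
have b0 : 0 <= b := le_trans (normr_ge0 _) (yb i).
have -> : 3 * b = 1 * b + 1 * (2 * b) by ring.
apply: (le_trans (ler_normD _ _)); apply: lerD.
  have /andP[s0 s1] := s01 i.
  by rewrite normrM (ger0_norm s0) ler_pM.
apply: (le_trans (ler_norm_sum _ _ _)).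
apply: (@le_trans _ _ ((\sum_j m i j) * (2 * b))); last first.
  by rewrite ler_wpM2r// mulr_ge0.
rewrite mulr_suml; apply: ler_sum => j _; rewrite normrM ger0_norm//.
rewrite ler_wpM2l// (le_trans (ler_normB _ _))//.
by have := yb i; have := yb j; lra.
Qed.

(** Exchanging [i] and [j] in the double sum and averaging the two forms turns [y i * (y i - y j)]
    into half of a square; this rests on the symmetry of [m]. *)
Lemma energyE s m y : diffusive s m ->
  energy s m y = \sum_i s i * y i ^+ 2 +
    2^-1 * \sum_i \sum_j m i j * (y i - y j) ^+ 2.
Proof.
move=> [_ _ msym _].
have -> : energy s m y =
    \sum_i s i * y i ^+ 2 + \sum_i \sum_j m i j * (y i * (y i - y j)).
  rewrite -big_split/=; apply: eq_bigr => i _.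
  rewrite mulrDr mulr_sumr; congr (_ + _); first by ring.
  by apply: eq_bigr => j _; ring.
congr (_ + _); set X := LHS.
have XE : X = \sum_i \sum_j m i j * (y j * (y j - y i)).
  rewrite /X exchange_big/=; apply: eq_bigr => i _; apply: eq_bigr => j _.
  by rewrite msym.
have -> : X = 2^-1 * (X + X) by field.
rewrite {2}XE /X -big_split/=; congr (_ * _); apply: eq_bigr => i _.
by rewrite -big_split/=; apply: eq_bigr => j _; ring.
Qed.

Lemma energy_ge0 s m y : diffusive s m -> 0 <= energy s m y.
Proof.
move=> sm; rewrite energyE//; have [s01 m0 _ _] := sm.
apply: addr_ge0.
  by apply: sumr_ge0 => i _; rewrite mulr_ge0 ?sqr_ge0//; case/andP: (s01 i).
rewrite mulr_ge0// ?invr_ge0//; apply: sumr_ge0 => i _; apply: sumr_ge0 => j _.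
by rewrite mulr_ge0 ?sqr_ge0.
Qed.

Lemma energy_ge_edge s m y i j : diffusive s m ->
  m i j * (y i - y j) ^+ 2 <= 2 * energy s m y.
Proof.
move=> sm; rewrite energyE//; have [s01 m0 _ _] := sm.
have S0 : 0 <= \sum_i s i * y i ^+ 2.
  by apply: sumr_ge0 => k _; rewrite mulr_ge0 ?sqr_ge0//; case/andP: (s01 k).
have mm k l : 0 <= m k l * (y k - y l) ^+ 2 by rewrite mulr_ge0 ?sqr_ge0.
have : m i j * (y i - y j) ^+ 2 <= \sum_i \sum_j m i j * (y i - y j) ^+ 2.
  rewrite (bigD1 i)//= (bigD1 j)//= -addrA lerDl addr_ge0// ?sumr_ge0// => k _.
  by rewrite sumr_ge0.
lra.
Qed.

Lemma energy_ge_node s m y i : diffusive s m ->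
  s i * y i ^+ 2 <= energy s m y.
Proof.
move=> sm; rewrite energyE//; have [s01 m0 _ _] := sm.
rewrite (bigD1 i)//= -!addrA lerDl addr_ge0//.
  by apply: sumr_ge0 => k _; rewrite mulr_ge0 ?sqr_ge0//; case/andP: (s01 k).
rewrite mulr_ge0// ?invr_ge0//; apply: sumr_ge0 => k _; apply: sumr_ge0 => l _.
by rewrite mulr_ge0 ?sqr_ge0.
Qed.

Lemma connect_norm_bound (e : rel 'I_n) y (r : R) :
  0 <= r -> (forall i j, e i j -> `|y i - y j| <= r) ->
  forall i j, connect e i j -> `|y i - y j| <= n%:R * r.
Proof.
move=> r0 er i j /connectP[p ep ->]; case/shortenP: ep => p' ep' up' _.
have sp : (size p' <= n)%N.
  have := max_card (mem (i :: p')); rewrite card_ord (card_uniqP up') /=.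
  exact: ltnW.
apply: (@le_trans _ _ ((size p')%:R * r)); last by rewrite ler_wpM2r// ler_nat.
elim: p' i ep' {up' sp} => [|k p' IH] i /=; first by rewrite subrr normr0 mul0r.
move=> /andP[eik /IH h].
have -> : y i - y (last k p') = (y i - y k) + (y k - y (last k p')) by ring.
by rewrite (le_trans (ler_normD _ _))// -[_.+1]add1n natrD mulrDl mul1r lerD// er.
Qed.

(** One squared coordinate is at most [2 * (1 + n^2 * (2 / delta))] times the energy; this factor is
    enlarged to a product, and the outer [n] sums over the nodes. *)
Definition coercivity (delta : R) := n%:R * ((1 + n%:R ^+ 2) * (2 * (1 + 2 / delta))).

(** A Poincare inequality for a fixed [y]: the pinned node controls one coordinate, and each edge
    that has weight at least [delta] at some time of the window controls a difference. Connectedness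
    of these edges reaches all other coordinates. *)
Lemma energy_coercive (W : seq nat) (s : nat -> 'I_n -> R)
    (m : nat -> 'I_n -> 'I_n -> R) (delta : R) y :
  0 < delta -> (forall t, diffusive (s t) (m t)) ->
  (forall i j, connect (fun i j => has (fun t => delta <= m t i j) W) i j) ->
  (exists2 t, t \in W & exists i, s t i = 1) ->
  \sum_i y i ^+ 2 <= coercivity delta * \sum_(t <- W) energy (s t) (m t) y.
Proof.
move=> d0 sm conn [t0 t0W [i0 si0]].
set q := \sum_(t <- W) _.
have le_q t : t \in W -> energy (s t) (m t) y <= q.
  move=> tW; rewrite /q (big_rem t)//= lerDl sumr_ge0// => u _.
  exact: energy_ge0.
have q0 : 0 <= q by apply: sumr_ge0 => u _; exact: energy_ge0.
have y0 : y i0 ^+ 2 <= q.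
  apply: le_trans (le_q _ t0W); have := energy_ge_node y i0 (sm t0).
  by rewrite si0 mul1r.
have d20 : 0 <= 2 / delta by rewrite divr_ge0// ltW.
pose r := Num.sqrt (2 / delta * q).
have rr : r ^+ 2 = 2 / delta * q by rewrite sqr_sqrtr// mulr_ge0.
have edge i j : has (fun t => delta <= m t i j) W -> `|y i - y j| <= r.
  move=> /hasP[t tW dm]; rewrite -(ler_pXn2r (n := 2))// ?nnegrE ?sqrtr_ge0//.
  rewrite real_normK ?num_real// rr mulrAC ler_pdivlMr//.
  apply: (@le_trans _ _ (2 * energy (s t) (m t) y)); last by rewrite ler_pM2l// le_q.
  apply: le_trans (energy_ge_edge y i j (sm t)).
  by rewrite mulrC ler_wpM2r// sqr_ge0.
have yi i : y i ^+ 2 <= (1 + n%:R ^+ 2) * (2 * (1 + 2 / delta)) * q.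
  have := connect_norm_bound (sqrtr_ge0 _) edge (conn i i0).
  rewrite -/r => h.
  have h2 : (y i - y i0) ^+ 2 <= n%:R ^+ 2 * (2 / delta * q).
    rewrite -rr -exprMn -[leLHS]real_normK ?num_real//.
    by rewrite ler_pXn2r ?nnegrE// mulr_ge0// sqrtr_ge0.
  have N0 : (0 : R) <= n%:R ^+ 2 by exact: sqr_ge0.
  have A0 := mulr_ge0 N0 q0; have B0 := mulr_ge0 d20 q0.
  (* This square equals [2 * y i0 ^ 2 + 2 * (y i - y i0) ^ 2 - y i ^ 2]. *)
  have := sqr_ge0 (y i - 2 * y i0).
  have -> : (1 + n%:R ^+ 2) * (2 * (1 + 2 / delta)) * q =
    2 * q + 2 * (2 / delta * q) + 2 * (n%:R ^+ 2 * q) + 2 * (n%:R ^+ 2 * (2 / delta * q)).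
    by ring.
  by move: h2; nra.
rewrite /coercivity -mulrA.
apply: le_trans (ler_sum _ (fun i _ => yi i)) _.
by rewrite sumr_const card_ord -[leLHS]mulr_natl.
Qed.

End diffusion.

(** * One window of the perturbed recursion *)

Section window.
Context (R : rcfType) (n : nat).
Variables (s : nat -> 'I_n -> R) (m : nat -> 'I_n -> 'I_n -> R).
Hypothesis sm : forall t, diffusive (s t) (m t).
Variables (h : nat -> R) (e y : nat -> 'I_n -> R).
Hypothesis yS : forall t i,
  y t.+1 i = y t i - h t * diffusion (s t) (m t) (y t) i + h t * e t i.
Variables (a W : nat) (H eps : R).
Hypothesis H1 : H <= 1.
Hypothesis hH : forall u, (u < W)%N -> 0 <= h (a + u)%N <= H.
Hypothesis eps_ge0 : 0 <= eps.
Hypothesis e_le : forall u i, (u < W)%N -> `|e (a + u)%N i| <= eps.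

(** A discrete Gronwall bound: the diffusion is at most 3 times the sup norm and [H <= 1], so one
    step sends a drift bound [K] to at most [4 * K + 3 * H * (b + eps)]. The [- 1] absorbs the
    source term. *)
Lemma window_drift b u i : 0 <= H -> 0 <= b -> (forall j, `|y a j| <= b) -> (u <= W)%N ->
  `|y (a + u)%N i - y a i| <= H * (4 ^+ u - 1) * (b + eps).
Proof.
move=> H0 b0 yb; elim: u i => [|u IH] i uW.
  by rewrite addn0 subrr normr0 expr0 subrr mulr0 mul0r.
rewrite addnS yS.
have /andP[h0 hle] := hH uW.
set K := H * (4 ^+ u - 1) * (b + eps) in IH.
have ybu j : `|y (a + u)%N j| <= b + K.
  rewrite -[y _ j](subrK (y a j)) addrC (le_trans (ler_normD _ _))// lerD//.
  exact: IH (ltnW uW).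
have p1 : 1 <= 4 ^+ u :> R by rewrite exprn_ege1// ler1n.
have K0 : 0 <= K.
  by rewrite !mulr_ge0 ?subr_ge0// addr_ge0.
have d1 := diffusion_bound i (sm (a + u)%N) ybu.
have e1 := e_le i uW.
have -> : y (a + u)%N i - h (a + u)%N * diffusion (s (a + u)%N) (m (a + u)%N) (y (a + u)%N) i
    + h (a + u)%N * e (a + u)%N i - y a i
  = (y (a + u)%N i - y a i) + h (a + u)%N * (e (a + u)%N i -
     diffusion (s (a + u)%N) (m (a + u)%N) (y (a + u)%N) i) by ring.
apply: (@le_trans _ _ (K + H * (eps + 3 * (b + K)))).
  apply: (le_trans (ler_normD _ _)); apply: lerD; first exact: IH (ltnW uW).
  rewrite normrM (ger0_norm h0) ler_pM//.
  by rewrite (le_trans (ler_normB _ _))// lerD.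
have HK : H * K <= K by rewrite -[leRHS]mul1r ler_wpM2r.
have He : 0 <= H * eps by rewrite mulr_ge0.
have -> : H * (4 ^+ u.+1 - 1) * (b + eps) = 4 * K + 3 * H * b + 3 * (H * eps).
  by rewrite /K exprS; ring.
lra.
Qed.

Let G i := \sum_(u < W) h (a + u)%N * diffusion (s (a + u)%N) (m (a + u)%N) (y a) i.

(** Linearity splits the displacement into [G], with the state frozen at the start of the window,
    and a remainder made of the noise and the diffusion of the drift. *)
Lemma window_sum i : y (a + W)%N i = y a i - G i +
  \sum_(u < W) h (a + u)%N * (e (a + u)%N i -
    diffusion (s (a + u)%N) (m (a + u)%N) (fun j => y (a + u)%N j - y a j) i).
Proof.
have aux k : y (a + k)%N i = y a i + \sum_(u < k) h (a + u)%N * (e (a + u)%N i -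
    diffusion (s (a + u)%N) (m (a + u)%N) (y (a + u)%N) i).
  elim: k => [|k IH]; first by rewrite addn0 big_ord0 addr0.
  by rewrite addnS yS IH big_ord_recr/=; ring.
rewrite aux -addrA; congr (_ + _); rewrite /G -sumrN -big_split/=.
apply: eq_bigr => u _; rewrite diffusionD diffusionN; ring.
Qed.

(** The remainder of a step is at most the noise, [eps], plus 3 times a drift of at most
    [H * 4 ^ W * (b + eps)]. *)
Definition drift_const : R := 1 + 3 * 4 ^+ W.
(** Multiplied by [H ^ 2 * (eps ^ 2 + H ^ 2 * V)], it bounds the sum of the squared remainders; the
    2 comes from [(p + q)^2 <= 2 * (p^2 + q^2)]. *)
Definition step_const : R := 2 * n%:R * W%:R ^+ 2 * drift_const ^+ 2.

Variables (g K : R).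
Hypothesis g_gt0 : 0 < g.
Hypothesis K_gt0 : 0 < K.
Hypothesis gK : g / K <= 1.
Hypothesis gh : forall u, (u < W)%N -> g * H <= h (a + u)%N.
Hypothesis coercive : \sum_i y a i ^+ 2 <=
  K * \sum_(u < W) energy (s (a + u)%N) (m (a + u)%N) (y a).

(** With [kap = g / K], pairing [y a] with [G] gives a decrease of [2 * kap * H] by coercivity.
    Young's inequality gives back [kap * H], and the smallness condition lets the second-order terms
    take at most [kap / 2 * H], so that [kap / 2 * H] survives. *)
Lemma window_contraction : 0 < H ->
  H * (18 * n%:R * W%:R ^+ 2 + step_const * (1 + K / g)) <= g / K / 2 ->
  \sum_i y (a + W)%N i ^+ 2 <= (1 - g / K / 2 * H) * \sum_i y a i ^+ 2 +
    step_const * (1 + K / g) * H * eps ^+ 2.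
Proof.
move=> Hp; have H0 := ltW Hp; set V := \sum_i y a i ^+ 2; move=> Hsmall.
have V0 : 0 <= V by apply: sumr_ge0 => i _; exact: sqr_ge0.
pose b := Num.sqrt V.
have b0 : 0 <= b by exact: sqrtr_ge0.
have bV : b ^+ 2 = V by rewrite sqr_sqrtr.
have yb j : `|y a j| <= b.
  rewrite -(ler_pXn2r (n := 2))// ?nnegrE// bV real_normK ?num_real//.
  by rewrite /V (bigD1 j)//= lerDl sumr_ge0// => i _; exact: sqr_ge0.
pose r i := \sum_(u < W) h (a + u)%N * (e (a + u)%N i -
    diffusion (s (a + u)%N) (m (a + u)%N) (fun j => y (a + u)%N j - y a j) i).
have yE i : y (a + W)%N i = (y a i - G i) + r i by exact: window_sum.
have sum_le (F : 'I_W -> R) c : (forall u, `|F u| <= c) -> `|\sum_u F u| <= W%:R * c.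
  move=> Fc; apply: (le_trans (ler_norm_sum _ _ _)).
  apply: (le_trans (ler_sum _ (fun u _ => Fc u))).
  by rewrite sumr_const card_ord -[leLHS]mulr_natl.
have GE i : `|G i| <= W%:R * (H * (3 * b)).
  apply: sum_le => u; have /andP[h0 hle] := hH (ltn_ord u).
  by rewrite normrM (ger0_norm h0) ler_pM//; exact: diffusion_bound.
set A := drift_const.
have A1 : 1 <= A by rewrite lerDl mulr_ge0// exprn_ge0.
have A0 : 0 <= A := le_trans ler01 A1.
have A3 : 3 * 4 ^+ W <= A by rewrite lerDr.
have rE i : `|r i| <= W%:R * (H * (A * (eps + H * b))).
  apply: sum_le => u; have /andP[h0 hle] := hH (ltn_ord u).
  rewrite normrM (ger0_norm h0) ler_pM//.
  apply: (le_trans (ler_normB _ _)).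
  have dr j : `|y (a + u)%N j - y a j| <= H * (4 ^+ W * (b + eps)).
    apply: (le_trans (window_drift j H0 b0 yb (ltnW (ltn_ord u)))).
    rewrite -mulrA ler_wpM2l// ler_wpM2r ?addr_ge0//.
    rewrite (@le_trans _ _ (4 ^+ u))// ?gerBl//.
    by rewrite ler_weXn2l ?ler1n// ltnW.
  have d1 := diffusion_bound i (sm (a + u)%N) dr.
  have e1 := e_le i (ltn_ord u).
  have P0 : (0 : R) <= 4 ^+ W by rewrite exprn_ge0.
  have HP : H * (4 ^+ W * eps) <= 4 ^+ W * eps by rewrite ler_piMl// mulr_ge0.
  have HPb : 0 <= H * b by rewrite mulr_ge0.
  apply: (le_trans (lerD e1 d1)).
  have -> : A * (eps + H * b) = eps + H * b + 3 * (4 ^+ W * eps) + 3 * (H * (4 ^+ W * b)).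
    by rewrite /A /drift_const; ring.
  by rewrite !mulrDr; lra.
have yG : g / K * H * V <= \sum_i y a i * G i.
  have -> : \sum_i y a i * G i =
      \sum_(u < W) h (a + u)%N * energy (s (a + u)%N) (m (a + u)%N) (y a).
    under eq_bigr do rewrite mulr_sumr.
    rewrite exchange_big/=; apply: eq_bigr => u _; rewrite mulr_sumr.
    by apply: eq_bigr => i _; ring.
  apply: (@le_trans _ _ (g * H * \sum_(u < W) energy (s (a + u)%N) (m (a + u)%N) (y a))).
    have -> : g / K * H * V = g * H * (V / K) by ring.
    by rewrite ler_wpM2l ?mulr_ge0// ?(ltW g_gt0)// ler_pdivrMr// mulrC.
  rewrite mulr_sumr; apply: ler_sum => u _.
  by rewrite ler_wpM2r ?gh// energy_ge0.
pose kap := g / K.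
have kap0 : 0 < kap by rewrite divr_gt0.
have G2 i : G i ^+ 2 <= 9 * W%:R ^+ 2 * H ^+ 2 * V.
  rewrite -(real_normK (num_real (G i))) -bV.
  have -> : 9 * W%:R ^+ 2 * H ^+ 2 * b ^+ 2 = (W%:R * (H * (3 * b))) ^+ 2 by ring.
  by rewrite ler_pXn2r ?nnegrE// !mulr_ge0.
have r2 i : r i ^+ 2 <= W%:R ^+ 2 * H ^+ 2 * A ^+ 2 * (2 * (eps ^+ 2 + H ^+ 2 * V)).
  rewrite -(real_normK (num_real (r i))) -bV.
  apply: (@le_trans _ _ ((W%:R * (H * (A * (eps + H * b)))) ^+ 2)).
    by rewrite ler_pXn2r ?nnegrE// !mulr_ge0// addr_ge0// mulr_ge0.
  have -> : (W%:R * (H * (A * (eps + H * b)))) ^+ 2 =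
    W%:R ^+ 2 * H ^+ 2 * A ^+ 2 * (eps + H * b) ^+ 2 by ring.
  rewrite ler_wpM2l ?mulr_ge0 ?sqr_ge0//.
  by have := sqr_ge0 (eps - H * b); nra.
have th0 : 0 < kap * H by rewrite mulr_gt0.
(* [(p + q)^2 <= (1 + theta) p^2 + (1 + 1/theta) q^2] with [theta = kap * H],
   so that the cross term costs only half of the decrease [2 * kap * H]. *)
have young p q : (p + q) ^+ 2 <= (1 + kap * H) * p ^+ 2 + (1 + (kap * H)^-1) * q ^+ 2 :> R.
  rewrite -subr_ge0.
  have -> : (1 + kap * H) * p ^+ 2 + (1 + (kap * H)^-1) * q ^+ 2 - (p + q) ^+ 2 =
    (kap * H)^-1 * (kap * H * p - q) ^+ 2 by field; rewrite gt_eqF// gt_eqF.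
  by rewrite mulr_ge0 ?sqr_ge0// invr_ge0 ltW.
pose C1 : R := 9 * n%:R * W%:R ^+ 2.
have C10 : 0 <= C1 by rewrite !mulr_ge0// sqr_ge0.
set S := step_const in Hsmall *.
have S0 : 0 <= S by rewrite !mulr_ge0 ?sqr_ge0.
have p2 : \sum_i (y a i - G i) ^+ 2 <= (1 - 2 * (kap * H) + C1 * H ^+ 2) * V.
  have -> : \sum_i (y a i - G i) ^+ 2 = V - 2 * (\sum_i y a i * G i) + \sum_i G i ^+ 2.
    rewrite mulr_sumr -sumrB -big_split/=; apply: eq_bigr => i _; ring.
  have G2s : \sum_i G i ^+ 2 <= C1 * H ^+ 2 * V.
    apply: (le_trans (ler_sum _ (fun i _ => G2 i))).
    rewrite sumr_const card_ord -[leLHS]mulr_natl /C1 le_eqVlt; apply/orP; left.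
    by apply/eqP; ring.
  have -> : (1 - 2 * (kap * H) + C1 * H ^+ 2) * V =
      V - 2 * (kap * H * V) + C1 * H ^+ 2 * V by ring.
  by rewrite lerD// lerD2l lerN2 ler_pM2l.
have r2s : \sum_i r i ^+ 2 <= S * H ^+ 2 * (eps ^+ 2 + H ^+ 2 * V).
  apply: (le_trans (ler_sum _ (fun i _ => r2 i))).
  rewrite sumr_const card_ord -[leLHS]mulr_natl /S /step_const le_eqVlt; apply/orP; left.
  by apply/eqP; rewrite -/A; ring.
have step1 : \sum_i y (a + W)%N i ^+ 2 <=
    (1 + kap * H) * \sum_i (y a i - G i) ^+ 2 + (1 + (kap * H)^-1) * \sum_i r i ^+ 2.
  rewrite !mulr_sumr -big_split/=; apply: ler_sum => i _.
  by rewrite yE; exact: young.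
apply: (le_trans step1).
have t1 : (1 + kap * H) * \sum_i (y a i - G i) ^+ 2 <=
    (1 + kap * H) * ((1 - 2 * (kap * H) + C1 * H ^+ 2) * V).
  by rewrite ler_wpM2l// addr_ge0// ltW.
pose Q := 1 + K / g.
have Qk : Q = 1 + kap^-1 by rewrite /Q /kap invf_div.
have Q0 : 0 <= Q by rewrite Qk addr_ge0// invr_ge0 ltW.
(* The Young factor [(kap * H)^-1] costs one power of [H]: the noise enters as [H * eps ^ 2], still
   proportional to the decrease. *)
have t2 : (1 + (kap * H)^-1) * \sum_i r i ^+ 2 <=
    S * Q * H * (eps ^+ 2 + H ^+ 2 * V).
  apply: (@le_trans _ _ ((1 + (kap * H)^-1) * (S * H ^+ 2 * (eps ^+ 2 + H ^+ 2 * V)))).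
    by rewrite ler_wpM2l// addr_ge0// invr_ge0 ltW.
  have -> : (1 + (kap * H)^-1) * (S * H ^+ 2 * (eps ^+ 2 + H ^+ 2 * V)) =
      S * (H * (H + kap^-1)) * (eps ^+ 2 + H ^+ 2 * V).
    by field; rewrite !gt_eqF.
  rewrite ler_wpM2r//; first by rewrite addr_ge0 ?mulr_ge0 ?sqr_ge0.
  rewrite -mulrA ler_wpM2l// mulrC ler_wpM2r// Qk lerD2r//.
apply: (le_trans (lerD t1 t2)).
(* Since [kap * H <= 1], expansion produces at most twice [C1 * H ^ 2], which is the 18 of the
   smallness condition. *)
have fin : (1 + kap * H) * (1 - 2 * (kap * H) + C1 * H ^+ 2) + S * Q * H * H ^+ 2
    <= 1 - kap / 2 * H.
  have kH1 : kap * H <= 1.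
    by rewrite -[1]mulr1 ler_pM// ltW.
  have SQ0 : 0 <= S * Q by rewrite mulr_ge0.
  have u1 : kap * H * (C1 * H ^+ 2) <= C1 * H ^+ 2.
    by rewrite ler_piMl// mulr_ge0// sqr_ge0.
  have u2 : S * Q * H * H ^+ 2 <= S * Q * H ^+ 2.
    by rewrite -(mulrA (S * Q)) ler_wpM2l// ler_piMl// sqr_ge0.
  have u3 : H * (H * (2 * C1 + S * Q)) <= H * (kap / 2).
    rewrite ler_wpM2l//; move: Hsmall; rewrite -/kap -/Q /C1.
    by rewrite !(mulrDr H); move=> /(le_trans _); apply; rewrite le_eqVlt; apply/orP; left; apply/eqP; ring.
  have u4 := sqr_ge0 (kap * H).
  by move: u1 u2 u3 u4; nra.
have := ler_wpM2r V0 fin.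
rewrite -/kap -/Q; nra.
Qed.

End window.

(** * Convergence of the deterministic recursion *)

(** The hypothesis is used with [delta / 2]. While [u] exceeds [delta], each step loses at least
    [alpha * H k * (delta / 2)], which cannot last because the sums of [H] are unbounded; once at
    most [delta], [u] stays so, by convex combination. *)
Lemma contraction_small (R : realFieldType) (u H : nat -> R) (alpha : R) :
  0 < alpha -> (forall k, 0 <= u k) -> (forall k, 0 <= H k) ->
  (forall A, exists N, A <= \sum_(k < N) H k) ->
  (forall delta, 0 < delta -> exists k0, forall k, (k0 <= k)%N ->
     alpha * H k <= 1 /\
     u k.+1 <= (1 - alpha * H k) * u k + alpha * H k * delta) ->
  forall delta, 0 < delta -> exists k0, forall k, (k0 <= k)%N -> u k <= delta.
Proof.
move=> al0 u0 H0 Hdiv uH delta d0.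
have d20 : 0 < delta / 2 by rewrite divr_gt0.
have [k0 hk0] := uH _ d20.
have [k1 k01 uk1] : exists2 k1, (k0 <= k1)%N & u k1 <= delta.
  apply: contrapT => nk.
  have big k : (k0 <= k)%N -> delta < u k.
    by move=> k0k; rewrite ltNge; apply/negP => ?; apply: nk; exists k.
  have dec j : u (k0 + j)%N <= u k0 - alpha * (delta / 2) * \sum_(i < j) H (k0 + i)%N.
    elim: j => [|j IH]; first by rewrite addn0 big_ord0 mulr0 subr0.
    have [_] := hk0 (k0 + j)%N (leq_addr _ _); rewrite addnS => h.
    have b := big (k0 + j)%N (leq_addr _ _).
    rewrite big_ord_recr/=.
    have : alpha * H (k0 + j)%N * (delta / 2) <= alpha * H (k0 + j)%N * (u (k0 + j)%N - delta / 2).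
      by rewrite ler_wpM2l ?mulr_ge0 ?(ltW al0)//; lra.
    by move: IH h; lra.
  (* Large enough to make the decrease after [k0] exceed [u k0], even when the first [k0] terms are
     discarded. *)
  have [N] := Hdiv (\sum_(k < k0) H k + (u k0 + 1) / (alpha * (delta / 2))).
  have c0 : 0 < alpha * (delta / 2) by rewrite mulr_gt0.
  move=> hN.
  have : \sum_(k < N) H k <= \sum_(k < k0 + N) H k.
    by rewrite -!(big_mkord xpredT) [leRHS](big_cat_nat _ (leq_addl k0 N))//= lerDl sumr_ge0.
  rewrite big_split_ord/= => hN'.
  have : (u k0 + 1) / (alpha * (delta / 2)) <= \sum_(i < N) H (k0 + i)%N.
    by have := le_trans hN hN'; rewrite lerD2l.
  rewrite ler_pdivrMr// => h; have := dec N; have := u0 (k0 + N)%N.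
  by move: h; lra.
exists k1 => k; elim: k => [|k IH].
  by rewrite leqn0 => /eqP k10; move: uk1; rewrite k10.
rewrite leq_eqVlt => /predU1P[<-//|]; rewrite ltnS => k1k.
have [a1] := hk0 k (leq_trans k01 k1k) => h; apply: (le_trans h).
have aH : 0 <= alpha * H k by rewrite mulr_ge0// ltW.
have : (1 - alpha * H k) * u k <= (1 - alpha * H k) * delta.
  by rewrite ler_wpM2l ?subr_ge0// IH.
have : 0 <= alpha * H k * delta by rewrite mulr_ge0// ltW.
by lra.
Qed.

(** By monotonicity, [W] times the first stepsize of a window dominates the sum over that window. *)
Lemma window_sums_unbounded (R : realFieldType) (h : nat -> R) (W : nat) :
  (0 < W)%N -> {homo h : i j / (i <= j)%N >-> j <= i} ->
  (forall t, 0 <= h t) ->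
  (forall A, exists N, A <= \sum_(t < N) h t.+1) ->
  forall A, exists N, A <= \sum_(k < N) h (k * W).+1.
Proof.
move=> W0 hmono h0 hdiv A.
have [N hN] := hdiv (W%:R * A); exists N.
have W0' : 0 < W%:R :> R by rewrite ltr0n.
rewrite -(ler_pM2l W0'); apply: (le_trans hN).
apply: (@le_trans _ _ (\sum_(t < N * W) h t.+1)).
  rewrite -!(big_mkord xpredT (fun t => h t.+1)).
  by rewrite [leRHS](big_cat_nat _ (leq_pmulr N W0))//= lerDl sumr_ge0.
elim: N {hN} => [|N IH]; first by rewrite mul0n !big_ord0 mulr0.
rewrite mulSnr big_split_ord/= big_ord_recr/= mulrDr lerD//.
apply: (@le_trans _ _ (\sum_(i < W) h (N * W).+1)).
  by apply: ler_sum => i _; apply: hmono; rewrite ltnS leq_addr.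
by rewrite sumr_const card_ord -[leLHS]mulr_natl.
Qed.

Section consensus.
Context (R : realType) (n : nat).
Variables (s : nat -> 'I_n -> R) (m : nat -> 'I_n -> 'I_n -> R).
Hypothesis sm : forall t, diffusive (s t) (m t).
Variables (h : nat -> R) (W : nat) (delta g : R).
Hypothesis h_gt0 : forall t, 0 < h t.
Hypothesis h_mono : {homo h : i j / (i <= j)%N >-> j <= i}.
Hypothesis h_cvg0 : h @ \oo --> (0 : R).
Hypothesis h_div : forall A, exists N, A <= \sum_(t < N) h t.+1.
Hypothesis W_gt0 : (0 < W)%N.
Hypothesis g_gt0 : 0 < g.
Hypothesis h_ratio : forall t, (0 < t)%N -> g * h t <= h (t + W)%N.
Hypothesis delta_gt0 : 0 < delta.
Hypothesis window_connected : forall k i j, connect (fun i j =>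
  has (fun t => delta <= m t i j) (index_iota (k * W).+1 ((k * W).+1 + W))) i j.
Hypothesis window_pinned : forall k,
  exists2 t, t \in index_iota (k * W).+1 ((k * W).+1 + W) & exists i, s t i = 1.

(** [window_contraction] and [contraction_small] make the squared norm at the window starts
    [k * W + 1] vanish; [window_drift] carries the limit to the times in between. *)
Lemma diffusion_cvg0 (e y : nat -> 'I_n -> R) :
  (forall t i, y t.+1 i = y t i - h t * diffusion (s t) (m t) (y t) i + h t * e t i) ->
  (forall i, e ^~ i @ \oo --> (0 : R)) ->
  forall i, y ^~ i @ \oo --> (0 : R).
Proof.
move=> yS e0 i.
pose K := coercivity n delta.
have n0 : (0 < n)%N by apply: leq_ltn_trans (ltn_ord i).
have n1 : 1 <= n%:R :> R by rewrite ler1n.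
have K1 : 1 <= K.
  rewrite /K /coercivity -[leLHS]mulr1 ler_pM// -[leLHS]mulr1 ler_pM//.
    by rewrite lerDl sqr_ge0.
  have : 0 <= 2 / delta by rewrite divr_ge0// ltW.
  lra.
have K0 : 0 < K := lt_le_trans ltr01 K1.
have g1 : g <= 1.
  have := le_trans (h_ratio (ltn0Sn 0)) (h_mono (leq_addr W 1)).
  by rewrite -ler_pdivlMr// divff// gt_eqF.
have gK : g / K <= 1 by rewrite ler_pdivrMr// mul1r (le_trans g1).
pose kap := g / K / 2.
have kap0 : 0 < kap by rewrite !divr_gt0.
pose D := 18 * n%:R * W%:R ^+ 2 + step_const R n W * (1 + K / g).
pose C := step_const R n W * (1 + K / g).
have Kg0 : 0 <= 1 + K / g by rewrite addr_ge0// divr_ge0 ?(ltW K0) ?(ltW g_gt0).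
have st0 : 0 <= step_const R n W by apply: mulr_ge0 (sqr_ge0 _); rewrite !mulr_ge0.
have C0 : 0 <= C by rewrite mulr_ge0.
have D0 : 0 <= D by apply: (addr_ge0 _ C0); rewrite !mulr_ge0 ?sqr_ge0.
pose a k := (k * W).+1.
have ka k : (k <= a k)%N by rewrite leqW// leq_pmulr.
have aS k : a k.+1 = (a k + W)%N by rewrite /a mulSnr addSn.
pose V k := \sum_i y (a k) i ^+ 2.
have V0 k : 0 <= V k by apply: sumr_ge0 => j _; exact: sqr_ge0.
have hsmall r : 0 < r -> exists N, forall t, (N <= t)%N -> h t <= r.
  move=> r0; have /cvgrPdist_le/(_ _ r0)[N _ HN] := h_cvg0; exists N => t Nt.
  have := HN t Nt; rewrite /= sub0r normrN ger0_norm//; exact: ltW.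
have esmall r : 0 < r -> exists N, forall t, (N <= t)%N -> forall i, `|e t i| <= r.
  move=> r0; have [N _ HN] : \forall t \near \oo, forall i, `|e t i| <= r.
    apply: filter_forall => j; have /cvgrPdist_le/(_ _ r0) := e0 j.
    by apply: filterS => t; rewrite sub0r normrN.
  by exists N => t; exact: HN.
have hH k u : (u < W)%N -> 0 <= h (a k + u)%N <= h (a k).
  by move=> _; rewrite ltW//= h_mono// leq_addr.
have Vsmall : forall r, 0 < r -> exists k0, forall k, (k0 <= k)%N -> V k <= r.
  apply: (@contraction_small R V (fun k => h (a k)) kap) => //.
  - by move=> k; exact: ltW.
  - exact: window_sums_unbounded (fun t => ltW (h_gt0 t)) h_div.
  move=> r r0.
  pose eta := Num.min 1 (kap * r / (C + 1)).
  have C10 : 0 < C + 1 by rewrite ltr_pwDr.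
  have eta0 : 0 < eta by rewrite lt_min ltr01/= divr_gt0// mulr_gt0.
  have etaC : C * eta ^+ 2 <= kap * r.
    have e1 : eta <= 1 by rewrite ge_min lexx.
    have e2 : eta * (C + 1) <= kap * r by rewrite -ler_pdivlMr// ge_min lexx orbT.
    have e3 : eta ^+ 2 <= eta by rewrite expr2 ler_piMl// ltW.
    have : C * eta ^+ 2 <= C * eta by rewrite ler_wpM2l.
    by move: e2 eta0; lra.
  have [N1 HN1] := hsmall 1 ltr01.
  have D1 : 0 < kap / (D + 1) by rewrite divr_gt0// ltr_pwDr.
  have [N2 HN2] := hsmall _ D1.
  have [N3 HN3] := esmall _ eta0.
  exists (maxn N1 (maxn N2 N3)) => k; rewrite !geq_max => /and3P[k1 k2 k3].
  have ak1 : h (a k) <= 1 by apply: HN1; exact: leq_trans (ka k).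
  have ak2 : h (a k) <= kap / (D + 1) by apply: HN2; exact: leq_trans (ka k).
  split.
    rewrite -[leRHS]mulr1 ler_pM//; try exact: ltW.
    rewrite /kap ler_pdivrMr//; lra.
  rewrite {1}/V aS.
  apply: le_trans (@window_contraction R n s m sm h e y yS (a k) W (h (a k)) eta
    ak1 (hH k) (ltW eta0) _ g K g_gt0 K0 gK _ _ (h_gt0 _) _) _.
  - move=> u j uW; apply: HN3; apply: leq_trans (leq_addr _ _).
    exact: leq_trans (ka k).
  - move=> u uW; apply: (le_trans (h_ratio _)); first by rewrite /a.
    by rewrite h_mono// leq_add2l ltnW.
  - have := @energy_coercive R n (index_iota (a k) (a k + W)) s m delta (y (a k))
      delta_gt0 sm (window_connected k) (window_pinned k).
    rewrite -[X in index_iota X]add0n big_addn addKn big_mkord.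
    by under [X in _ <= _ * X]eq_bigr do rewrite addnC.
  - rewrite -/kap; move: ak2; rewrite ler_pdivlMr; last by rewrite ltr_pwDr.
    rewrite mulrDr mulr1 => /(le_trans _); apply; rewrite lerDl; exact: ltW.
  rewrite lerD2l -/C.
  have -> : C * h (a k) * eta ^+ 2 = h (a k) * (C * eta ^+ 2) by ring.
  have -> : kap * h (a k) * r = h (a k) * (kap * r) by ring.
  by rewrite ler_wpM2l// ltW.
apply/cvgrPdist_le => r r0.
(* A window start of size at most [r / Z] plus a drift of at most [4 ^ W * (2 * r / Z)] gives
   exactly [r]. *)
pose Z : R := 1 + 2 * 4 ^+ W.
have Z0 : 0 < Z by rewrite ltr_pwDl// mulr_ge0// exprn_ge0.
have rZ : 0 < r / Z by rewrite divr_gt0.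
have [N1 HN1] := hsmall 1 ltr01.
have [N2 HN2] := esmall _ rZ.
have rZ2 : 0 < (r / Z) ^+ 2 by rewrite exprn_gt0.
have [N3 HN3] := Vsmall _ rZ2.
exists ((maxn N1 (maxn N2 N3)).+1 * W).+1%N => // t /= Nt.
rewrite sub0r normrN.
(* Window [k] starts at [k * W + 1], hence the predecessor of [t]. *)
pose k := ((t.-1) %/ W)%N; pose u := ((t.-1) %% W)%N.
have tE : t = (a k + u)%N.
  by rewrite /a /k /u addSn -divn_eq prednK//; exact: leq_ltn_trans Nt.
have kN : (maxn N1 (maxn N2 N3) <= k)%N.
  rewrite /k leq_divRL// (@leq_trans ((maxn N1 (maxn N2 N3)).+1 * W))//.
    by rewrite leq_mul2r leqnSn orbT.
  by rewrite -ltnS prednK//; exact: leq_ltn_trans Nt.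
move: kN; rewrite !geq_max => /and3P[k1 k2 k3].
have uW : (u < W)%N by rewrite ltn_mod.
have yb j : `|y (a k) j| <= r / Z.
  rewrite -(ler_pXn2r (n := 2))// ?nnegrE ?(ltW rZ)// real_normK ?num_real//.
  apply: le_trans (HN3 _ k3); rewrite /V (bigD1 j)//= lerDl sumr_ge0// => l _.
  exact: sqr_ge0.
have ak1 : h (a k) <= 1 by apply: HN1; exact: leq_trans (ka k).
have ee v j : (v < W)%N -> `|e (a k + v)%N j| <= r / Z.
  move=> _; apply: HN2; apply: leq_trans (leq_addr _ _); exact: leq_trans (ka k).
have := @window_drift R n s m sm h e y yS (a k) W (h (a k)) (r / Z) ak1 (hH k)
  (ltW rZ) ee (r / Z) u i (ltW (h_gt0 _)) (ltW rZ) yb (ltnW uW).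
rewrite -tE => dr.
have p1 : 4 ^+ u - 1 <= 4 ^+ W :> R.
  by rewrite (@le_trans _ _ (4 ^+ u)) ?gerBl// ler_weXn2l ?ler1n// ltnW.
have p0 : 0 <= 4 ^+ u - 1 :> R by rewrite subr_ge0 exprn_ege1// ler1n.
have dr' : h (a k) * (4 ^+ u - 1) * (r / Z + r / Z) <= 4 ^+ W * (r / Z + r / Z).
  rewrite ler_wpM2r ?addr_ge0 ?(ltW rZ)// -[leRHS]mul1r ler_pM//; exact: ltW.
rewrite -[y t i](subrK (y (a k) i)) (le_trans (ler_normD _ _))//.
apply: (le_trans (lerD (le_trans dr dr') (yb i))).
have -> : 4 ^+ W * (r / Z + r / Z) + r / Z = r / Z * Z by rewrite /Z; ring.
by rewrite divfK// gt_eqF.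
Qed.

(* Adding the tail sum of the noise to x replaces e t by
   h t times the diffusion of that tail, which tends to 0. *)
Lemma consensus_cvg0 (e x : nat -> 'I_n -> R) :
  (forall t i, x t.+1 i = x t i - h t * diffusion (s t) (m t) (x t) i + e t i) ->
  (forall i, cvgn (series (e ^~ i))) ->
  forall i, x ^~ i @ \oo --> (0 : R).
Proof.
move=> xS ce i.
pose sg t i := limn (series (e ^~ i)) - series (e ^~ i) t.
have sg0 j : sg ^~ j @ \oo --> (0 : R).
  rewrite -(subrr (limn (series (e ^~ j)))).
  by apply: cvgB; [exact: cvg_cst|exact: ce].
pose y t i := x t i + sg t i.
have yS t j : y t.+1 j = y t j - h t * diffusion (s t) (m t) (y t) j +
    h t * diffusion (s t) (m t) (sg t) j.
  rewrite /y diffusionD xS /sg seriesSr; ring.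
have y0 : y ^~ i @ \oo --> (0 : R).
  apply: diffusion_cvg0 yS _ _ => j.
  apply/cvgrPdist_le => r r0.
  have r30 : 0 < r / 3 by rewrite divr_gt0.
  have : \forall t \near \oo, forall l, `|sg t l| <= r / 3.
    apply: filter_forall => l; have /cvgrPdist_le/(_ _ r30) := sg0 l.
    by apply: filterS => t; rewrite sub0r normrN.
  apply: filterS => t Ht; rewrite sub0r normrN.
  apply: (le_trans (diffusion_bound j (sm t) Ht)).
  by rewrite mulrC divfK.
have -> : x ^~ i = (y ^~ i) \- (sg ^~ i).
  by apply/funext => t; rewrite /y /= addrK.
rewrite -(subr0 (0 : R)); exact: cvgB.
Qed.

End consensus.

(** * Almost sure convergence of series *)

Section martingale.
Context d (T : measurableType d) (R : realType) (P : probability T R).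

Let measurable_sub_sigma (C : set (set T)) (A : set T) :
  C `<=` measurable -> <<s C >> A -> measurable A.
Proof. by move=> Cm; apply: smallest_sub => //; exact: sigma_algebra_measurable. Qed.

(* Split A according to the sign of S: the integral of X vanishes on both parts. *)
Lemma le_Rintegral_normD (C : set (set T)) (S X : T -> R) (A : set T) :
  C `<=` measurable ->
  P.-integrable [set: T] (EFin \o S) -> P.-integrable [set: T] (EFin \o X) ->
  measurable_fun [set: g_sigma_algebraType C] (S : g_sigma_algebraType C -> R) ->
  (forall A, <<s C >> A -> \int[P]_(x in A) X x = 0) ->
  <<s C >> A ->
  \int[P]_(x in A) `|S x| <= \int[P]_(x in A) `|S x + X x|.
Proof.
move=> Cm iS iX mS X0 CA.
have CP : <<s C >> (S @^-1` `[0, +oo[).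
  by rewrite -[X in <<s C >> X]setTI; exact: mS.
have CN : <<s C >> (S @^-1` `]-oo, 0[).
  by rewrite -[X in <<s C >> X]setTI; exact: mS.
pose A1 := A `&` S @^-1` `[0, +oo[; pose A2 := A `&` S @^-1` `]-oo, 0[.
have CA1 : <<s C >> A1 by exact: (@measurableI _ (g_sigma_algebraType C)).
have CA2 : <<s C >> A2 by exact: (@measurableI _ (g_sigma_algebraType C)).
have mA := measurable_sub_sigma Cm CA.
have mA1 := measurable_sub_sigma Cm CA1.
have mA2 := measurable_sub_sigma Cm CA2.
have AE : A = A1 `|` A2.
  rewrite /A1 /A2 -setIUr -preimage_setU -[LHS]setIT; congr (_ `&` _).
  apply/seteqP; split => // x _ /=; rewrite !in_itv/= andbT.
  by case: (leP 0 (S x)) => _; [left|right].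
have A12 : [disjoint A1 & A2].
  apply/disj_setPS => x [] [_ /=]; rewrite in_itv/= andbT => Sx [_ /=].
  by rewrite in_itv/= ltNge Sx.
have iA (B : set T) f : measurable B -> P.-integrable [set: T] (EFin \o f) ->
    P.-integrable B (EFin \o f).
  by move=> mB; apply: integrableS.
have iSX : P.-integrable [set: T] (EFin \o (fun x => S x + X x)).
  exact: (@integrableD _ _ _ P _ measurableT (EFin \o S) (EFin \o X)).
have iNS := integrable_norm iS.
have iNSX := integrable_norm iSX.
rewrite AE !Rintegral_setU -?AE//; try exact: iA.
apply: lerD.
- rewrite (@eq_Rintegral _ _ _ _ _ S); last first.
    by move=> x; rewrite inE => -[_ /=]; rewrite in_itv/= andbT => /ger0_norm.
  rewrite -[leLHS]addr0 -(X0 _ CA1) -RintegralD//; try exact: iA.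
  by apply: le_Rintegral => //; [exact: iA|exact: iA|move=> x _; exact: ler_norm].
- rewrite (@eq_Rintegral _ _ _ _ _ (fun x => -1 * S x)); last first.
    move=> x; rewrite inE => -[_ /=]; rewrite in_itv/= => /ltr0_norm ->.
    by rewrite mulN1r.
  rewrite RintegralZl//; last exact: iA.
  rewrite -[X in _ * X <= _]addr0 -(X0 _ CA2) -RintegralD//; try exact: iA.
  rewrite -RintegralZl//; last exact: iA.
  apply: le_Rintegral => //; [|exact: iA|].
    apply: iA => //; exact: (@integrableZl _ _ _ P _ measurableT (-1) _ iSX).
  by move=> x _; rewrite mulN1r -normrN ler_norm.
Qed.

(** * Maximal inequalities for sums of centred increments *)

Section doob.
Variables (C : nat -> set (set T)) (Z : nat -> T -> R).
Hypothesis Cm : forall m, C m `<=` measurable.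
Hypothesis iZ : forall m, P.-integrable [set: T] (EFin \o Z m).
Hypothesis mZ : forall m j, (j < m)%N ->
  measurable_fun [set: g_sigma_algebraType (C m)]
    (Z j : g_sigma_algebraType (C m) -> R).
Hypothesis Z0 : forall m A, <<s C m >> A -> \int[P]_(x in A) Z m x = 0.

Let S m x := \sum_(i < m) Z i x.

Let iS m : P.-integrable [set: T] (EFin \o S m).
Proof.
rewrite (_ : _ \o _ = fun x => (\sum_(i < m) (EFin \o Z i) x)%E); last first.
  by apply/funext => x /=; rewrite /S sumEFin.
exact: integrable_sum.
Qed.

Let exceed eps m : set T := \bigcup_(j in `I_m.+1) [set x | eps <= `|S j x|].

Let exceedS eps m :
  exceed eps m.+1 = exceed eps m `|` [set x | eps <= `|S m.+1 x|].
Proof.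
by rewrite /exceed IIS bigcup_setU bigcup_set1.
Qed.

Let mS m j : (j <= m)%N ->
  measurable_fun [set: g_sigma_algebraType (C m)]
    (S j : g_sigma_algebraType (C m) -> R).
Proof.
by move=> jm; apply: measurable_sum => i; apply: mZ; exact: leq_trans jm.
Qed.

Let C_exceed eps m j : (j <= m)%N -> <<s C m >> [set x | eps <= `|S j x|].
Proof.
move=> jm.
rewrite (_ : [set x | _] = (fun x => `|S j x|) @^-1` `[eps, +oo[); last first.
  by apply/seteqP; split => x /=; rewrite in_itv/= andbT.
rewrite -[X in <<s C m >> X]setTI.
have mn : measurable_fun [set: g_sigma_algebraType (C m)]
    ((fun x => `|S j x|) : g_sigma_algebraType (C m) -> R).
  by apply: measurableT_comp => //; exact: mS.
exact: mn.
Qed.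

(* In the L^1 form below, the proof only needs the increments to have zero
   integral over past events; no product of unbounded functions occurs. *)
Lemma doob_maximal (eps : R) m :
  eps * fine (P (\bigcup_(j in `I_m.+1) [set x | eps <= `|\sum_(i < j) Z i x|]))
  <= \int[P]_x `|\sum_(i < m) Z i x|.
Proof.
rewrite -/(exceed eps m) -/(S m).
(* Only the [Z j] with [j < k] occur in [exceed eps k], so it is an event of the past of [Z k]. *)
have Ce k : <<s C k >> (exceed eps k).
  apply: (@bigcup_measurable _ (g_sigma_algebraType (C k))) => j /=.
  by rewrite ltnS; exact: C_exceed.
have iNS k := integrable_norm (iS k).
have iA (B : set T) f : measurable B -> P.-integrable [set: T] (EFin \o f) ->
    P.-integrable B (EFin \o f).
  by move=> mB; apply: integrableS.
(* The bound is proved with the integral over [exceed eps m] only; this stronger form passes through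
   the induction. *)
apply: (@le_trans _ _ (\int[P]_(x in exceed eps m) `|S m x|)); last first.
  have me := measurable_sub_sigma (@Cm _) (Ce m).
  rewrite -[X in _ <= Rintegral _ X _](setUv (exceed eps m)) Rintegral_setU//.
  - by rewrite lerDl; exact: Rintegral_ge0.
  - exact: measurableC.
  - by rewrite setUv; exact: iNS.
  - by apply/disj_setPS => x [].
elim: m => [|m IH].
  have me := measurable_sub_sigma (@Cm _) (Ce 0%N).
  rewrite -Rintegral_cst//; apply: le_Rintegral => //; [|exact: (iA _ _ me (iNS _))|].
    exact: finite_measure_integrable_cst.
  by move=> x [j /=]; rewrite ltnS leqn0 => /eqP ->.
have me := measurable_sub_sigma (@Cm _) (Ce m).
have mE : measurable [set x | eps <= `|S m.+1 x|].
  exact: (measurable_sub_sigma (@Cm _) (C_exceed eps (leqnn m.+1))).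
(* Points that reach [eps] for the first time at [m + 1]. There [|S m.+1|] is at least [eps]; on the
   earlier event, adding [Z m] does not decrease the integral of [|S m|]. *)
pose N := [set x | eps <= `|S m.+1 x|] `\` exceed eps m.
have mN : measurable N by exact: measurableD.
have eN : [disjoint exceed eps m & N].
  by apply/disj_setPS => x [ex [_ /(_ ex)]].
have -> : exceed eps m.+1 = exceed eps m `|` N.
  rewrite exceedS; apply/seteqP; split=> x [|]; [by left| |by left|by case; right].
  by move=> Sx; have [?|?] := pselect (exceed eps m x); [left|right].
rewrite Rintegral_setU//; last first.
  by apply: (iA _ _ _ (iNS _)); exact: measurableU.
rewrite measureU//; last by apply/disj_set2P.
rewrite fineD ?fin_num_measure// mulrDr; apply: lerD.
  apply: (le_trans IH).
  rewrite [leRHS](_ : _ = \int[P]_(x in exceed eps m) `|S m x + Z m x|).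
    exact: (le_Rintegral_normD (@Cm m) (iS m) (iZ m) (mS (leqnn m)) (@Z0 m) (Ce m)).
  by apply: eq_Rintegral => x _; rewrite /S big_ord_recr.
rewrite -Rintegral_cst//; apply: le_Rintegral => //; [|exact: (iA _ _ mN (iNS _))|by move=> x []].
exact: finite_measure_integrable_cst.
Qed.

Hypothesis iZ2 : forall m, P.-integrable [set: T] (EFin \o (fun x => Z m x ^+ 2)).
Hypothesis ZZ : forall i j, (i < j)%N ->
  P.-integrable [set: T] (EFin \o (fun x => Z i x * Z j x)) /\
  \int[P]_x (Z i x * Z j x) = 0.

Lemma Rintegral_sum_sqr m :
  P.-integrable [set: T] (EFin \o (fun x => (\sum_(i < m) Z i x) ^+ 2)) /\
  \int[P]_x (\sum_(i < m) Z i x) ^+ 2 = \sum_(i < m) \int[P]_x Z i x ^+ 2.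
Proof.
(* The bound [j] is separate from [n] so that the induction can extend the partial sum while [Z n]
   stays fixed. *)
have cross n j : (j <= n)%N ->
    P.-integrable [set: T] (EFin \o (fun x => (\sum_(i < j) Z i x) * Z n x)) /\
    \int[P]_x ((\sum_(i < j) Z i x) * Z n x) = 0.
  elim: j => [_|j IH jn].
    under eq_fun do rewrite big_ord0 mul0r.
    by split; [exact: integrable0|rewrite Rintegral_cst// mul0r].
  have [i1 e1] := IH (ltnW jn); have [i2 e2] := ZZ jn.
  under eq_fun do rewrite big_ord_recr/= mulrDl.
  split; last by rewrite RintegralD// e1 e2 addr0.
  exact: (@integrableD _ _ _ P _ measurableT _ _ i1 i2).
elim: m => [|m [i1 e1]].
  under eq_fun do rewrite big_ord0 expr0n.
  by rewrite big_ord0; split; [exact: integrable0|rewrite Rintegral_cst// mul0r].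
have [i2 e2] := cross m m (leqnn m).
have i3 : P.-integrable [set: T]
    (EFin \o (fun x => 2 * ((\sum_(i < m) Z i x) * Z m x))).
  exact: (@integrableZl _ _ _ P _ measurableT 2 _ i2).
have i4 : P.-integrable [set: T] (EFin \o (fun x => (\sum_(i < m) Z i x) ^+ 2 +
    2 * ((\sum_(i < m) Z i x) * Z m x))).
  exact: (@integrableD _ _ _ P _ measurableT _ _ i1 i3).
have E x : (\sum_(i < m.+1) Z i x) ^+ 2 = (\sum_(i < m) Z i x) ^+ 2 +
    2 * ((\sum_(i < m) Z i x) * Z m x) + Z m x ^+ 2.
  by rewrite big_ord_recr/=; ring.
under eq_fun do rewrite E.
split; first exact: (@integrableD _ _ _ P _ measurableT _ _ i4 (iZ2 m)).
by rewrite RintegralD// RintegralD// RintegralZl// e1 e2 mulr0 addr0 big_ord_recr.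
Qed.

(** The integral of [|S m|] is at most [eta] by [|s| <= s^2 / (2 * eta) + eta / 2], which takes the
    place of Cauchy-Schwarz; the L^1 maximal inequality explains the first power of [eps]. *)
Lemma kolmogorov_maximal (eps eta : R) m : 0 < eta ->
  \sum_(i < m) \int[P]_x Z i x ^+ 2 <= eta ^+ 2 ->
  eps * fine (P (\bigcup_(j in `I_m.+1) [set x | eps <= `|\sum_(i < j) Z i x|]))
  <= eta.
Proof.
move=> eta0 h; apply: (le_trans (doob_maximal _ _)).
have [i1 e1] := Rintegral_sum_sqr m; rewrite -e1 in h.
have i2 : P.-integrable [set: T] (EFin \o (fun x => (2 * eta)^-1 * (\sum_(i < m) Z i x) ^+ 2)).
  exact: (@integrableZl _ _ _ P _ measurableT _ _ i1).
have i3 : P.-integrable [set: T] (EFin \o cst (eta / 2)).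
  exact: finite_measure_integrable_cst.
apply: (@le_trans _ _ (\int[P]_x ((2 * eta)^-1 * (\sum_(i < m) Z i x) ^+ 2 + eta / 2))).
  apply: le_Rintegral => //.
  - exact: (integrable_norm (iS m)).
  - exact: (@integrableD _ _ _ P _ measurableT _ _ i2 i3).
  move=> x _; rewrite -(real_normK (num_real (\sum_(i < m) Z i x))).
  set a := `|_|; rewrite -subr_ge0.
  have -> : (2 * eta)^-1 * a ^+ 2 + eta / 2 - a = (2 * eta)^-1 * (a - eta) ^+ 2.
    by field; rewrite gt_eqF.
  by rewrite mulr_ge0 ?sqr_ge0// invr_ge0 mulr_ge0// ltW.
have e3 : \int[P]_x (eta / 2) = eta / 2.
  by rewrite Rintegral_cst// -[RHS]mulr1; congr (_ * _); exact: (congr1 fine (probability_setT P)).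
rewrite (RintegralD measurableT i2 i3) RintegralZl// e3.
rewrite -lerBrDr -ler_pdivlMl ?invr_gt0 ?mulr_gt0// invrK (le_trans h)//.
by rewrite le_eqVlt; apply/orP; left; apply/eqP; field.
Qed.

End doob.

(** The maximal inequality, applied to tails, makes it arbitrarily unlikely that some partial sum
    from [N] on reaches [eps], so almost every path is Cauchy. Each step works within its own [C m],
    so the classes may be other than a filtration. *)
Lemma ae_cvg_series (C : nat -> set (set T)) (Z : nat -> T -> R) :
  (forall m, C m `<=` measurable) ->
  (forall m, P.-integrable [set: T] (EFin \o Z m)) ->
  (forall m j, (j < m)%N -> measurable_fun [set: g_sigma_algebraType (C m)]
    (Z j : g_sigma_algebraType (C m) -> R)) ->
  (forall m A, <<s C m >> A -> \int[P]_(x in A) Z m x = 0) ->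
  (forall m, P.-integrable [set: T] (EFin \o (fun x => Z m x ^+ 2))) ->
  (forall i j, (i < j)%N ->
    P.-integrable [set: T] (EFin \o (fun x => Z i x * Z j x)) /\
    \int[P]_x (Z i x * Z j x) = 0) ->
  cvgn (series (fun m => \int[P]_x Z m x ^+ 2)) ->
  {ae P, forall x, cvgn (series (fun m => Z m x))}.
Proof.
move=> Cm iZ mZ Z0 iZ2 ZZ cvgZ2.
pose V eps N j : set T := [set x | eps <= `|\sum_(i < j) Z (N + i)%N x|].
have mV eps N j : measurable (V eps N j).
  have mS : measurable_fun [set: T] (fun x => `|\sum_(i < j) Z (N + i)%N x|).
    apply: measurableT_comp => //; apply: measurable_sum => i.
    exact/measurable_EFinP/(measurable_int P)/iZ.
  rewrite /V (_ : [set x | _] = (fun x => `|\sum_(i < j) Z (N + i)%N x|) @^-1` `[eps, +oo[).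
    by rewrite -[X in measurable X]setTI; exact: mS.
  by apply/seteqP; split => x /=; rewrite in_itv/= andbT.
pose U eps N := \bigcup_j V eps N j.
have mU eps N : measurable (U eps N) by exact: bigcup_measurable.
have PU eps : 0 < eps -> forall e, 0 < e -> exists N, (P (U eps N) <= e%:E)%E.
  move=> eps0 e e0.
  have ee0 : 0 < (eps * e) ^+ 2 by rewrite exprn_gt0// mulr_gt0.
  have /cauchy_cvgP/cauchy_seriesP/(_ _ ee0) := cvgZ2.
  move=> [[Q1 Q2] /= [[N1 _ HN1] [N2 _ HN2]] H].
  pose N := maxn N1 N2; exists N.
  have tail m : \sum_(i < m) \int[P]_x Z (N + i)%N x ^+ 2 <= (eps * e) ^+ 2.
    have := H (N, (N + m)%N); rewrite /= => HH.
    have /HH /ltW : Q1 N /\ Q2 (N + m)%N.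
      split; [apply: HN1 => /=; exact: leq_maxl|apply: HN2 => /=].
      exact: (leq_trans (leq_maxr N1 N2) (leq_addr _ _)).
    rewrite -{1}[N]add0n big_addn addKn big_mkord => /(le_trans (ler_norm _)).
    by under eq_bigr do rewrite addnC.
  have bnd m : (P (\bigcup_(j in `I_m.+1) V eps N j) <= e%:E)%E.
    have := @kolmogorov_maximal (fun m => C (N + m)%N) (fun m => Z (N + m)%N)
      _ _ _ _ _ _ eps (eps * e) m _ (tail m).
    rewrite ler_pM2l// -lee_fin fineK; last first.
      by rewrite fin_num_measure//; apply: bigcup_measurable => k _; exact: mV.
    apply => // [i j ij|i A|i j ij|]; [|exact: Z0| |exact: mulr_gt0].
      by apply: mZ; rewrite ltn_add2l.
    by apply: ZZ; rewrite ltn_add2l.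
  have UE : U eps N = \bigcup_m \bigcup_(j in `I_m.+1) V eps N j.
    apply/seteqP; split => [x [j _ Vx]|x [m _ [j _ Vx]]]; last by exists j.
    by exists j => //; exists j => /=.
  rewrite UE.
  have : P \o (fun m => \bigcup_(j in `I_m.+1) V eps N j) @ \oo -->
      P (\bigcup_m \bigcup_(j in `I_m.+1) V eps N j).
    apply: nondecreasing_cvg_mu.
    - by move=> m; exact: bigcup_measurable.
    - by apply: bigcup_measurable => m _; exact: bigcup_measurable.
    - move=> a b ab; apply/subsetPset => x [j /= ja Vx]; exists j => //=.
      exact: leq_trans ja _.
  move=> cv; rewrite -(cvg_lim _ cv)//; apply: lime_le; first by apply/cvg_ex; eexists; exact: cv.
  by apply: nearW => m /=; exact: bnd.
(* The series can diverge only where, for some [p], every tail has a partial sum of size at least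
   [1 / (p + 1)]; each such set is null by [PU]. *)
apply: (@negligibleS _ _ _ _ (\bigcup_p \bigcap_N U p.+1%:R^-1 N)); last first.
  apply: negligible_bigcup => p.
  have mI : measurable (\bigcap_N U p.+1%:R^-1 N) by exact: bigcap_measurable.
  exists (\bigcap_N U p.+1%:R^-1 N); split => //.
  apply/eqP; rewrite eq_le measure_ge0 andbT; apply/lee_addgt0Pr => e e0.
  have p0 : 0 < p.+1%:R^-1 :> R by rewrite invr_gt0.
  have [N HN] := PU _ p0 _ e0; rewrite add0e; apply: le_trans HN.
  apply: le_measure; rewrite ?inE//; exact: bigcap_inf.
move=> x /= /(contra_notP _); apply => nU.
apply/cauchy_cvgP/cauchy_seriesP => e e0.
have [p pe] : exists p, p.+1%:R^-1 < e / 2.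
  have e20 : 0 < e / 2 by rewrite divr_gt0.
  have [p _ Hp] := near_infty_natSinv_lt (PosNum e20).
  by exists p; exact: (Hp p (leqnn p)).
have [N HN] : exists N, ~ U p.+1%:R^-1 N x.
  apply: contrapT => /forallNP h; apply: nU; exists p => // N _.
  exact: contrapT.
have small j : `|\sum_(i < j) Z (N + i)%N x| < e / 2.
  apply: lt_trans pe; rewrite ltNge; apply/negP => h; apply: HN.
  by exists j.
have small' j : (N <= j)%N -> `|\sum_(N <= k < j) Z k x| < e / 2.
  move=> Nj; rewrite -{1}[N]add0n big_addn big_mkord.
  by under eq_bigr do rewrite addnC; exact: small.
exists ([set a | (N <= a)%N], [set b | (N <= b)%N]) => /=.
  by split; exists N.
move=> [a b] /= [Na Nb].
have [ab|/ltnW ba] := leqP a b; last by rewrite big_geq// normr0.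
have -> : \sum_(a <= k < b) Z k x = \sum_(N <= k < b) Z k x - \sum_(N <= k < a) Z k x.
  by rewrite (big_cat_nat Na ab)/= addrAC subrr add0r.
by rewrite (le_lt_trans (ler_normB _ _))// [e]splitr ltrD// small'.
Qed.
End martingale.

(** * Integrals of products of independent variables *)

Section independence.
Context d (T : measurableType d) (R : realType) (P : probability T R).

(* The joint law of U and V is a product measure, so Fubini applies. *)
Lemma Rintegral_mul_indep (U V : T -> R) :
  measurable_fun [set: T] U ->
  P.-integrable [set: T] (EFin \o V) -> \int[P]_x V x = 0 ->
  P.-integrable [set: T] (EFin \o (fun x => U x * V x)) ->
  (forall A B, measurable A -> measurable B ->
    P (U @^-1` A `&` V @^-1` B) = (P (U @^-1` A) * P (V @^-1` B))%E) ->
  \int[P]_x (U x * V x) = 0.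
Proof.
move=> mU iV V0 iUV UV.
have mV : measurable_fun [set: T] V by exact/measurable_EFinP/(measurable_int P).
pose U' : {mfun T >-> R} :=
  MeasurableFun.Pack (MeasurableFun.Class (isMeasurableFun.Build _ _ _ _ _ mU)).
pose V' : {mfun T >-> R} :=
  MeasurableFun.Pack (MeasurableFun.Class (isMeasurableFun.Build _ _ _ _ _ mV)).
have mW : measurable_fun [set: T] (fun x => (U x, V x)) by exact: measurable_fun_pair.
pose W' : {mfun T >-> (R * R)%type} :=
  MeasurableFun.Pack (MeasurableFun.Class (isMeasurableFun.Build _ _ _ _ _ mW)).
pose f (z : R * R) : \bar R := (z.1 * z.2)%:E.
have mf : measurable_fun [set: R * R] f.
  by apply/measurable_EFinP; exact: measurable_funM.
have eqm A : measurable A ->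
    (distribution P U' \x distribution P V')%E A = distribution P W' A.
  by apply: (@product_measure_unique _ _ _ _ R (distribution P U') (distribution P V') (distribution P W')).
have if1 : (distribution P W').-integrable [set: R * R] f.
  exact: (@integrable_pushforward _ _ _ _ _ _ mW P setT f mf iUV).
have if2 : (distribution P U' \x distribution P V')%E.-integrable [set: R * R] f.
  apply/integrableP; split => //.
  have /integrableP[_] := if1; apply: le_lt_trans.
  by rewrite (eq_measure_integral (distribution P W'))// => A mA _; exact: eqm.
rewrite /Rintegral.
have -> : (\int[P]_x (U x * V x)%:E = \int[distribution P W']_z f z)%E.
  by rewrite integral_distribution.
rewrite (eq_measure_integral (distribution P U' \x distribution P V')%E); last first.
  by move=> A mA _; exact/esym/eqm.
rewrite -integral12_prod_meas1//.
rewrite integral0_eq// => u _.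
have V0' : (\int[distribution P V']_y y%:E = 0)%E.
  rewrite (@integral_distribution _ _ _ _ _ P V' EFin _ iV)//=.
  by rewrite -[LHS]fineK ?integrable_fin_num//; congr EFin.
rewrite /fubini_F; under eq_integral do rewrite /f/= EFinM.
rewrite integralZl//; first by rewrite V0' mule0.
exact: (@integrable_pushforward _ _ _ _ _ _ mV P setT EFin _ iV).
Qed.

(** The product lemma with the indicator of [A] as first factor; its preimages are the full set,
    [A], its complement and the empty set. *)
Lemma Rintegral_indep_set (A : set T) (V : T -> R) :
  measurable A ->
  P.-integrable [set: T] (EFin \o V) -> \int[P]_x V x = 0 ->
  (forall B, measurable B -> P (A `&` V @^-1` B) = (P A * P (V @^-1` B))%E) ->
  \int[P]_(x in A) V x = 0.
Proof.
move=> mA iV V0 AV.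
have mV : measurable_fun [set: T] V by exact/measurable_EFinP/(measurable_int P).
have E : V \_ A = (fun x => \1_A x * V x).
  by apply/funext => x; rewrite patchE indicE; case: ifP; rewrite ?mul1r ?mul0r.
rewrite Rintegral_mkcond E; apply: Rintegral_mul_indep => //.
  rewrite -E -restrict_EFin; apply: (integrable_mkcond _ mA).1.
  exact: integrableS iV.
move=> B C mB mC.
have mVC : measurable (V @^-1` C) by rewrite -[X in measurable X]setTI; exact: mV.
rewrite preimage_indic; case: ifP => _; case: ifP => _.
- by rewrite setTI probability_setT mul1e.
- exact: AV.
- have PA : P A \is a fin_num by exact: fin_num_measure.
  have PQ : P (V @^-1` C) \is a fin_num by exact: fin_num_measure.
  have -> : P (~` A `&` V @^-1` C) = (P (V @^-1` C) - P (A `&` V @^-1` C))%E.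
    by rewrite setIC -setDE measureD//; [rewrite setIC|rewrite -ge0_fin_numE].
  rewrite (AV C mC) probability_setC//.
  rewrite -(fineK PA) -(fineK PQ) -EFinM -!EFinB -EFinM.
  by congr EFin; ring.
- by rewrite set0I measure0 mul0e.
Qed.

End independence.

Lemma measurable_coord (R : realType) (l : nat) (k : 'I_l) :
  measurable_fun [set: borel_rV R l] ((fun v => v ord0 k) : borel_rV R l -> R).
Proof.
apply: (measurability _ (RGenOpens.measurableE R)).
move=> _ [_ [a [b ->]] <-]; rewrite setTI.
apply: sub_sigma_algebra => /=.
by apply: open_comp => [v _|]; [exact: coord_continuous|exact: interval_open].
Qed.

(** * Independence of one noise from all the others *)

Section independent_family.
Context (R : realType) (l : nat) d (T : measurableType d) (P : probability T R).
Variables (I : choiceType) (D : set I) (X : I -> T -> 'rV[R]_l).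
Hypothesis indX : mutually_independent P D X.
Hypothesis rX : forall x, D x -> random_vector (X x).

(* These generate the sigma-algebra of all active noises other than X x, which
   plays the role of the past of X x for every enumeration of the noises. *)
Definition cylinders (x : I) : set (set T) :=
  [set A | exists (J : {fset I}) (B : I -> set (borel_rV R l)),
    [/\ [set` J] `<=` D `\ x, forall j, j \in J -> measurable (B j) &
        A = \bigcap_(j in [set` J]) (X j @^-1` B j)]].

Let mpre x (B : set (borel_rV R l)) : D x -> measurable B -> measurable (X x @^-1` B).
Proof. by move=> Dx mB; rewrite -[X in measurable X]setTI; exact: rX. Qed.

Lemma cylinders_measurable x : cylinders x `<=` measurable.
Proof.
move=> _ [J [B [JD mB ->]]]; apply: fin_bigcap_measurable => // j Jj.
by apply: mpre; [exact: (JD _ Jj).1|exact: mB].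
Qed.

(** This is the pi-system property that the Dynkin argument requires; an index missing from one of
    the two sets gets the trivial condition [setT]. *)
Lemma cylinders_setI x : setI_closed (cylinders x).
Proof.
move=> _ _ [J1 [B1 [J1D mB1 ->]]] [J2 [B2 [J2D mB2 ->]]].
exists (J1 `|` J2)%fset, (fun j => (if j \in J1 then B1 j else setT) `&`
  (if j \in J2 then B2 j else setT)); split.
- by move=> j /=; rewrite inE => /orP[]; [exact: J1D|exact: J2D].
- by move=> j _; apply: measurableI; case: ifPn => // ?; [exact: mB1|exact: mB2].
- apply/seteqP; split => [w [h1 h2] j /= _|w h].
    by split; case: ifPn => // ?; [exact: h1|exact: h2].
  split => j /= jJ.
    by have := h j; rewrite /= inE jJ => /(_ isT) [].
  by have := h j; rewrite /= inE jJ orbT => /(_ isT) [].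
Qed.

Lemma measurable_cylinders x y : D y -> y != x ->
  measurable_fun [set: g_sigma_algebraType (cylinders x)]
    (X y : g_sigma_algebraType (cylinders x) -> borel_rV R l).
Proof.
move=> Dy yx _ B mB; rewrite setTI; apply: sub_sigma_algebra.
exists [fset y]%fset, (fun=> B); split => //.
  by move=> j /=; rewrite inE => /eqP ->; split => //; exact/eqP.
apply/seteqP; split => [w Bw j /=|w]; first by rewrite inE => /eqP ->.
by apply; rewrite /= inE.
Qed.

(** Adjoin [x] to the index set of the cylinder, with condition [B], and compare the product
    formulas of the two index sets. *)
Lemma cylinders_indep x A (B : set (borel_rV R l)) :
  D x -> cylinders x A -> measurable B ->
  P (A `&` X x @^-1` B) = (P A * P (X x @^-1` B))%E.
Proof.
move=> Dx [J [C [JD mC ->]]] mB.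
have xJ : x \notin J by apply/negP => /JD [_ /=]; exact.
pose C' j := if j == x then B else C j.
have C'J j : j \in J -> C' j = C j.
  by move=> jJ; rewrite /C'; case: eqP => // jx; rewrite -jx jJ in xJ.
have := indX (J := (x |` J)%fset) _ (A := C').
have C'x : C' x = B by rewrite /C' eqxx.
rewrite big_fsetU1//= C'x.
have -> : \bigcap_(j in [set` (x |` J)%fset]) (X j @^-1` C' j) =
    \bigcap_(j in [set` J]) (X j @^-1` C j) `&` X x @^-1` B.
  apply/seteqP; split => [w h|w [h1 h2] j /=].
    split => [j /= jJ|]; last first.
      by have := h x; rewrite /= fset1U1 C'x; apply.
    by have := h j; rewrite /= in_fset1U jJ orbT C'J// => /(_ isT).
  rewrite in_fset1U => /orP[/eqP ->|jJ]; first by rewrite C'x.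
  by rewrite C'J//; exact: h1.
move=> ->; last 2 first.
- by move=> j /=; rewrite in_fset1U => /orP[/eqP ->//|/JD []].
- move=> j; rewrite in_fset1U /C'; case: ifPn => // jx /= jJ; exact: mC.
rewrite muleC; congr (_ * _)%E; rewrite (indX (J := J)) => [||//]; last first.
  by move=> j /JD [].
by apply: eq_big_seq => j jJ; rewrite C'J.
Qed.

(** The events over which the integral vanishes form a Dynkin class; it contains the cylinders by
    independence, hence the generated sigma-algebra. *)
Lemma Rintegral_cylinders x (f : borel_rV R l -> R) A : D x ->
  measurable_fun [set: borel_rV R l] f ->
  P.-integrable [set: T] (EFin \o (f \o X x)) -> \int[P]_w f (X x w) = 0 ->
  <<s cylinders x >> A -> \int[P]_(w in A) f (X x w) = 0.
Proof.
move=> Dx mf iV V0.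
have sub B : <<s cylinders x >> B -> measurable B.
  apply: smallest_sub; [exact: sigma_algebra_measurable|exact: cylinders_measurable].
have iA (B : set T) : measurable B -> P.-integrable B (EFin \o (f \o X x)).
  by move=> mB; apply: integrableS iV.
apply: (@dynkin_induction _ (g_sigma_algebraType (cylinders x)) (cylinders x)
  (fun B => \int[P]_(w in B) f (X x w) = 0)) => //.
- exact: cylinders_setI.
- move=> B CB; apply: Rintegral_indep_set => //; first exact: cylinders_measurable CB.
  move=> C mC; rewrite (_ : _ @^-1` C = X x @^-1` (f @^-1` C))//.
  apply: cylinders_indep => //.
  by rewrite -[X in measurable X]setTI; exact: mf.
- move=> B /sub mB B0.
  have : \int[P]_(w in B `|` ~` B) f (X x w) = 0 by rewrite setUv.
  rewrite Rintegral_setU ?B0 ?add0r//; first exact: measurableC.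
    by rewrite setUv.
  by apply/disj_setPS => w [].
- move=> F mF tF F0; rewrite /Rintegral integral_bigcup//; last 2 first.
  + by move=> k; exact: (sub _ (mF k)).
  + by apply: iA; apply: bigcup_measurable => k _; exact: (sub _ (mF k)).
  rewrite eseries0// => k _ _.
  have mFk := sub _ (mF k).
  by rewrite -[LHS]fineK ?integrable_fin_num//; [congr EFin; exact: F0|exact: iA].
Qed.

End independent_family.

Section integrable_sqr.
Context d (T : measurableType d) (R : realType) (P : probability T R).

Lemma integrable_mul (U V : T -> R) :
  measurable_fun [set: T] U -> measurable_fun [set: T] V ->
  P.-integrable [set: T] (EFin \o (fun x => U x ^+ 2)) ->
  P.-integrable [set: T] (EFin \o (fun x => V x ^+ 2)) ->
  P.-integrable [set: T] (EFin \o (fun x => U x * V x)).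
Proof.
move=> mU mV iU iV.
apply: (le_integrable _ _ _ (integrableD _ iU iV)) => //.
  by apply/measurable_EFinP; exact: measurable_funM.
move=> x _ /=; rewrite lee_fin [leRHS]ger0_norm; last first.
  by rewrite addr_ge0 ?sqr_ge0.
rewrite ler_norml; have := sqr_ge0 (U x + V x); have := sqr_ge0 (U x - V x).
by move=> h1 h2; apply/andP; split; nra.
Qed.

(** With mean 0 the variance is the second moment; being the real number [s2], it is finite, which
    yields square integrability. *)
Lemma zero_mean_sqr (l : nat) (X : T -> 'rV[R]_l) (s2 : R) (k : 'I_l) :
  zero_mean_with_variance P X s2 ->
  [/\ P.-integrable [set: T] (EFin \o (fun w => X w ord0 k)),
      \int[P]_w X w ord0 k = 0,
      P.-integrable [set: T] (EFin \o (fun w => X w ord0 k ^+ 2)) &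
      \int[P]_w X w ord0 k ^+ 2 = s2].
Proof.
move=> /(_ k) /= [iX EX VX].
have mX : measurable_fun [set: T] (fun w => X w ord0 k).
  exact/measurable_EFinP/(measurable_int P).
have X2 : (\int[P]_w (X w ord0 k ^+ 2)%:E = s2%:E)%E.
  rewrite -VX /variance unlock EX unlock; apply: eq_integral => w _ /=.
  by rewrite [X in _ = X%:E](_ : _ = (X w ord0 k - 0) * (X w ord0 k - 0))// subr0 expr2.
split => //.
- by rewrite /Rintegral; move: EX; rewrite unlock => ->.
- apply/integrableP; split.
    by apply/measurable_EFinP; exact: measurable_funX.
  under eq_integral => w _ do rewrite /= ger0_norm ?sqr_ge0//.
  by rewrite X2 ltry.
- by rewrite /Rintegral X2.
Qed.

End integrable_sqr.

(** For use with [ix] following one node, or one ordered pair, through time. Only active noises are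
    controlled, so an inactive index contributes 0; injectivity of [ix] makes distinct terms
    independent. *)
Lemma ae_cvg_weighted_noise (R : realType) (l : nat) d (T : measurableType d)
    (P : probability T R) (I : choiceType) (D : set I) (X : I -> T -> 'rV[R]_l)
    (ix : nat -> I) (s2 : R) (a : nat -> R) (k : 'I_l) :
  mutually_independent P D X -> (forall x, D x -> random_vector (X x)) ->
  injective ix ->
  (forall t, D (ix t) -> zero_mean_with_variance P (X (ix t)) s2) ->
  cvgn (series (fun t => a t ^+ 2)) ->
  {ae P, forall w, cvgn (series (fun t =>
    if `[< D (ix t) >] then a t * X (ix t) w ord0 k else 0))}.
Proof.
move=> indX rX ixI mvX cva.
pose f t (v : borel_rV R l) : R := a t * v ord0 k.
have mf t : measurable_fun [set: borel_rV R l] (f t).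
  by apply: measurable_funM => //; exact: measurable_coord.
pose Z t w : R := if `[< D (ix t) >] then f t (X (ix t) w) else 0.
have Zin t : D (ix t) -> Z t = f t \o X (ix t).
  by move=> Dt; apply/funext => w; rewrite /Z asboolT.
have Zout t : ~ D (ix t) -> Z t = cst 0.
  by move=> Dt; apply/funext => w; rewrite /Z asboolF.
have ZP t : [/\ measurable_fun [set: T] (Z t),
    P.-integrable [set: T] (EFin \o Z t), \int[P]_w Z t w = 0,
    P.-integrable [set: T] (EFin \o (fun w => Z t w ^+ 2)) &
    (* The absolute value keeps the bound nonnegative even at an inactive index, which gives no
       information on the sign of [s2]. *)
    \int[P]_w Z t w ^+ 2 <= a t ^+ 2 * `|s2|].
  have [Dt|Dt] := pselect (D (ix t)); last first.
    rewrite Zout//=; split => //.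
    - exact: integrable0.
    - by rewrite Rintegral_cst// mul0r.
    - by under eq_fun do rewrite expr0n; exact: integrable0.
    - by under eq_Rintegral do rewrite expr0n; rewrite Rintegral_cst// mul0r mulr_ge0// sqr_ge0.
  rewrite Zin//=; have [i1 e1 i2 e2] := zero_mean_sqr k (mvX _ Dt).
  have E w : f t (X (ix t) w) ^+ 2 = a t ^+ 2 * X (ix t) w ord0 k ^+ 2.
    by rewrite /f exprMn.
  split.
  - by apply: measurableT_comp (mf t) _; exact: rX.
  - exact: (@integrableZl _ _ _ P _ measurableT (a t) _ i1).
  - by rewrite RintegralZl// e1 mulr0.
  - under eq_fun do rewrite E.
    exact: (@integrableZl _ _ _ P _ measurableT (a t ^+ 2) _ i2).
  - under eq_Rintegral do rewrite E.
    by rewrite RintegralZl// e2 ler_wpM2l ?sqr_ge0// ler_norm.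
have Zindep i j : i != j -> forall A B, measurable A -> measurable B ->
    P (Z i @^-1` A `&` Z j @^-1` B) = (P (Z i @^-1` A) * P (Z j @^-1` B))%E.
  move=> ij A B mA mB.
  have cstE (C : set R) : (cst 0 : T -> R) @^-1` C = setT \/ (cst 0 : T -> R) @^-1` C = set0.
    have [C0|C0] := pselect (C 0); [left|right]; apply/seteqP; split => //.
  have [Di|Di] := pselect (D (ix i)); last first.
    rewrite (Zout i Di); case: (cstE A) => ->.
      by rewrite setTI probability_setT mul1e.
    by rewrite set0I measure0 mul0e.
  have [Dj|Dj] := pselect (D (ix j)); last first.
    rewrite (Zout j Dj); case: (cstE B) => ->.
      by rewrite setIT probability_setT mule1.
    by rewrite setI0 measure0 mule0.
  rewrite !Zin// (_ : (f j \o X (ix j)) @^-1` B = X (ix j) @^-1` (f j @^-1` B))//.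
  apply: (cylinders_indep indX) => //.
    exists [fset (ix i)]%fset, (fun=> f i @^-1` A); split.
    - move=> x /=; rewrite inE => /eqP ->; split => //=.
      by move=> /ixI; exact/eqP.
    - by move=> x _; rewrite -[X in measurable X]setTI; exact: mf.
    - apply/seteqP; split => [w Aw x /=|w]; first by rewrite inE => /eqP ->.
      by apply; rewrite /= inE.
  by rewrite -[X in measurable X]setTI; exact: mf.
apply: (@ae_cvg_series _ _ _ P (fun t => cylinders D X (ix t)) Z).
- by move=> m; exact: cylinders_measurable.
- by move=> m; have [] := ZP m.
- move=> m j jm; have [Dj|Dj] := pselect (D (ix j)); last first.
    by rewrite Zout//; exact: measurable_cst.
  rewrite Zin//; apply: measurableT_comp (mf j) _.
  apply: measurable_cylinders => //.
  by apply/eqP => /ixI jm'; rewrite jm' ltnn in jm.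
- move=> m A CA; have [Dm|Dm] := pselect (D (ix m)); last first.
    by rewrite Zout//= /Rintegral integral0_eq.
  have [_] := ZP m; rewrite Zin// => i1 i2 _ _.
  exact: (Rintegral_cylinders indX rX Dm (mf m) i1 i2 CA).
- by move=> m; have [] := ZP m.
- move=> i j ij; have [mi ii ei i2 _] := ZP i; have [mj ij' ej j2 _] := ZP j.
  have iij := integrable_mul mi mj i2 j2; split => //.
  apply: Rintegral_mul_indep => //; apply: Zindep.
  by rewrite neq_ltn ij.
- apply: (@series_le_cvg _ _ (fun t => a t ^+ 2 * `|s2|)).
  + by move=> t; apply: Rintegral_ge0 => w _; exact: sqr_ge0.
  + by move=> t; rewrite mulr_ge0// sqr_ge0.
  + by move=> t; have [] := ZP t.
  + rewrite (_ : (fun t => _) = `|s2| *: (fun t => a t ^+ 2)); last first.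
      by apply/funext => t; rewrite mulrC.
    exact: is_cvg_seriesZ.
Qed.

(** * The learning protocol *)

Lemma cvg_mx_coord (R : realType) (k l : nat) (u : nat -> 'M[R]_(k, l)) (M : 'M[R]_(k, l)) :
  (forall i j, (fun t => u t i j) @ \oo --> M i j) -> u @ \oo --> M.
Proof.
move=> cv A [Q Qmu sQA].
have : \forall t \near \oo, forall i j, Q i j (u t i j).
  apply: filter_forall => i; apply: filter_forall => j.
  exact: (cv i j _ (Qmu i j)).
by apply: filterS => t; exact: sQA.
Qed.

Lemma is_cvg_series_sum (R : realType) (I : finType) (F : I -> nat -> R) :
  (forall i, cvgn (series (F i))) -> cvgn (series (fun t => \sum_i F i t)).
Proof.
move=> cF.
suff : forall r : seq I, cvgn (series (fun t => \sum_(i <- r) F i t)) by exact.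
elim=> [|i r IH].
  under eq_fun do rewrite big_nil.
  rewrite (_ : series _ = cst 0); first exact: is_cvg_cst.
  by apply/funext => N; rewrite /series/= big1.
under eq_fun do rewrite big_cons.
exact: (is_cvg_seriesD (cF i) IH).
Qed.

(** * Stepsize hypotheses in real-valued form *)

Section stepsizes.
Context (R : realType) (Delta : nat -> R).
Hypothesis Delta_ge0 : forall t, 0 <= Delta t.
Hypothesis Delta_mono : {homo Delta : s t / (s <= t)%N >-> t <= s}.

Lemma eseries_pinfty_unbounded :
  (\sum_(1 <= t <oo) (Delta t)%:E = +oo)%E ->
  forall A, exists N, A <= \sum_(t < N) Delta t.+1.
Proof.
move=> D A; apply: contrapT => /forallNP nA.
suff : (\sum_(1 <= t <oo) (Delta t)%:E <= A%:E)%E by rewrite D leye_eq.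
apply: lime_le; first by apply: is_cvg_nneseries => t _ _; rewrite lee_fin.
apply: nearW => -[|N]; rewrite sumEFin lee_fin.
  rewrite big_geq//; have /negP := nA 0%N; rewrite big_ord0 -ltNge; exact: ltW.
rewrite big_add1 big_mkord ltW// ltNge; exact/negP.
Qed.

(** By monotonicity a zero stepsize is followed by zeros only, and the partial sums would stay
    bounded. The ratio hypothesis could not exclude this by itself, since division by 0 yields 0. *)
Lemma stepsize_gt0 :
  (forall A, exists N, A <= \sum_(t < N) Delta t.+1) -> forall t, 0 < Delta t.
Proof.
move=> D t0; rewrite lt_neqAle Delta_ge0 andbT; apply/negP => /eqP Dt0.
have [N] := D (\sum_(t < t0) Delta t.+1 + 1).
apply/negP; rewrite -ltNge ltr_pwDr//.
apply: (@le_trans _ _ (\sum_(t < t0 + N) Delta t.+1)).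
  rewrite -!(big_mkord xpredT (fun t => Delta t.+1)).
  by rewrite [leRHS](big_cat_nat _ (leq_addl t0 N))//= lerDl sumr_ge0.
rewrite big_split_ord/= gerDl big1// => i _; apply/eqP.
by rewrite eq_le Delta_ge0 andbT Dt0 Delta_mono// -addnS leq_addr.
Qed.

Lemma series_sqr_cvg :
  (\sum_(1 <= t <oo) (Delta t ^+ 2)%:E < +oo)%E ->
  cvgn (series (fun t => Delta t ^+ 2)).
Proof.
move=> D; apply: nondecreasing_is_cvgn.
  by apply/nondecreasing_seqP => N; rewrite seriesSr lerDl sqr_ge0.
set S := (\sum_(1 <= t <oo) _)%E in D.
have S0 : (0 <= S)%E by apply: nneseries_ge0 => t _ _; rewrite lee_fin sqr_ge0.
(* The hypothesis starts at time 1 and the series at time 0, hence the extra term. *)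
exists (Delta 0%N ^+ 2 + fine S) => _ [N _ <-].
have [->|N0] := posnP N.
  by rewrite /series/= big_geq// addr_ge0 ?sqr_ge0 ?fine_ge0.
rewrite /series/= (big_cat_nat _ (n := 1))//= big_nat1 lerD2l.
rewrite -lee_fin fineK ?ge0_fin_numE// -sumEFin.
by apply: nneseries_lim_ge => t _ _; rewrite lee_fin sqr_ge0.
Qed.

Lemma sqr_cvg0 : cvgn (series (fun t => Delta t ^+ 2)) -> Delta @ \oo --> (0 : R).
Proof.
move=> /cvg_series_cvg_0 D; apply/cvgrPdist_le => r r0.
have r20 : 0 < r ^+ 2 by rewrite exprn_gt0.
move/cvgrPdist_le : D => /(_ _ r20); apply: filterS => t.
rewrite !sub0r !normrN (ger0_norm (sqr_ge0 _)) ger0_norm// ler_pXn2r//.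
  exact: Delta_ge0.
exact: ltW.
Qed.

Lemma stepsize_ratio (c : nat) : (forall t, 0 < Delta t) ->
  (ereal_sup [set (Delta t / Delta (t + c)%N)%:E | t in [set t | (1 <= t)%N]]
       < +oo)%E ->
  exists2 g, 0 < g & forall t, (0 < t)%N -> g * Delta t <= Delta (t + c)%N.
Proof.
move=> D0; set S := ereal_sup _ => Soo.
have Sub t : (0 < t)%N -> ((Delta t / Delta (t + c)%N)%:E <= S)%E.
  by move=> t0; apply: ereal_sup_ubound; exists t.
have Sfin : S \is a fin_num.
  rewrite fin_numElt Soo andbT; apply: lt_le_trans (Sub 1%N isT).
  exact: ltNyr.
have Sub' t : (0 < t)%N -> Delta t / Delta (t + c)%N <= fine S.
  by move=> t0; rewrite -lee_fin fineK// Sub.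
have S0 : 0 < fine S by apply: lt_le_trans (Sub' 1%N isT); rewrite divr_gt0.
exists (fine S)^-1; first by rewrite invr_gt0.
by move=> t /Sub'; rewrite ler_pdivrMr// ler_pdivrMl.
Qed.

End stepsizes.

(** Induction on the start: a measurement time in the window stays in the shifted one unless it is
    the point dropped; then the next measurement time, less than [T] later, takes its place. *)
Lemma measurement_within (n : nat) (S : nat -> {set 'I_n}) (tau : nat -> nat) (T : nat) :
  measurement_times S tau -> tau 0%N = 1%N ->
  (forall k, (tau k.+1 - tau k < T)%N) ->
  forall a, (0 < a)%N -> exists2 t, (a <= t < a + T)%N & S t != finset.set0.
Proof.
move=> [tau_mono tauP] tau0 gap.
have T0 : (0 < T)%N by apply: leq_ltn_trans (gap 0%N).
have H a : exists k, (a.+1 <= tau k < a.+1 + T)%N.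
  elim: a => [|a [k /andP[k1 k2]]]; first by exists 0%N; rewrite tau0 /= add1n ltnS.
  have [ka|ka] := ltnP a.+1 (tau k).
    by exists k; rewrite ka/= (ltn_trans k2)// addSn ltnS.
  have tk : tau k = a.+1 by apply/eqP; rewrite eqn_leq ka k1.
  have tS := tau_mono _ _ (ltnSn k); exists k.+1.
  rewrite -tk tS/= -ltn_subLR ?(ltnW tS)//.
  by rewrite (leq_ltn_trans _ (gap k))// leq_sub2l.
case=> // a _; have [k kP] := H a; exists (tau k) => //.
by apply/tauP; exists k.
Qed.

(** * Metropolis weights *)

Section graph_weights.
Context (R : realType) (n : nat).
Implicit Types (e : rel 'I_n).

(* For adjacent nodes the maximum is positive, so no inverse of 0 occurs. *)
Definition weight e (i j : 'I_n) : R :=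
  if e i j then (maxn (degree e i) (degree e j))%:R^-1 else 0.

Lemma weight_ge0 e i j : 0 <= weight e i j.
Proof. by rewrite /weight; case: ifP => // _; rewrite invr_ge0. Qed.

Lemma weight_le1 e i j : weight e i j <= 1.
Proof.
rewrite /weight; case: ifP => // _; case: (maxn _ _) => [|k]; first by rewrite invr0.
by rewrite invf_le1// ler1n.
Qed.

Lemma degree_gt0 e i j : e i j -> (0 < degree e i)%N.
Proof. by move=> eij; apply/card_gt0P; exists j; rewrite inE. Qed.

Lemma degree_le e i : (degree e i <= n)%N.
Proof. by rewrite -[leqRHS]card_ord max_card. Qed.

(** Uniform in time, so [n^-1] can serve as the threshold [delta] of the coercivity estimate. *)
Lemma weight_ge_edge e i j : e i j -> n%:R^-1 <= weight e i j.
Proof.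
move=> eij; rewrite /weight eij; have d0 := degree_gt0 eij.
have m0 : (0 < maxn (degree e i) (degree e j))%N by rewrite leq_max d0.
rewrite lef_pV2 ?posrE ?ltr0n//; first by rewrite ler_nat geq_max !degree_le.
exact: leq_trans d0 (degree_le _ _).
Qed.

(** For the row sums: row [i] has one nonzero entry per neighbour, each at most the inverse of the
    degree of [i]. *)
Lemma weight_diffusive e (M : {set 'I_n}) : symmetric e ->
  diffusive (fun i => (i \in M)%:R : R) (weight e).
Proof.
move=> esym; split.
- by move=> i; case: (i \in M); rewrite /= lexx ler01.
- exact: weight_ge0.
- by move=> i j; rewrite /weight esym maxnC.
move=> i; rewrite /weight -big_mkcond/=.
have [d0|d0] := posnP (degree e i).
  rewrite big1// => j eij; have := degree_gt0 eij; by rewrite d0.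
apply: (@le_trans _ _ (\sum_(j | e i j) (degree e i)%:R^-1)).
  apply: ler_sum => j eij; rewrite lef_pV2 ?posrE ?ltr0n ?leq_max ?d0//.
  by rewrite ler_nat leq_maxl.
rewrite sumr_const -[_ *+ _]mulr_natl.
have -> : #|[pred j | e i j]| = degree e i.
  by apply: eq_card => j; rewrite !inE.
by rewrite divff// pnatr_eq0 -lt0n.
Qed.

End graph_weights.

(** * From almost sure convergence of the noise series to the limit of the protocol *)

Theorem proposition1p1 (R : realType) (n l : nat) (mu : 'rV[R]_l)
  (d : measure_display) (Omega : measurableType d) (P : probability Omega R)
  (E : nat -> rel 'I_n) (B : nat)
  (E_simple : forall t : nat, simple_graph (E t))
  (B_gt0 : (0 < B)%N) (E_connected : B_connected B E)
  (S : nat -> {set 'I_n}) (tau : nat -> nat) (T : nat)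
  (tauP : measurement_times S tau) (tau0 : tau 0%N = 1%N)
  (T_gt0 : (0 < T)%N) (tau_gap : forall k : nat, (tau k.+1 - tau k < T)%N)
  (sigma sigma' : R)
  (wm : nat -> 'I_n -> Omega -> 'rV[R]_l)
  (wo : nat -> 'I_n -> 'I_n -> Omega -> 'rV[R]_l)
  (noiseP : noise_model P E S sigma sigma' wm wo)
  (Delta : nat -> R)
  (Delta_ge0 : forall t : nat, 0 <= Delta t)
  (Delta_nonincreasing : {homo Delta : s t / (s <= t)%N >-> t <= s})
  (Delta_sum : (\sum_(1 <= t <oo) (Delta t)%:E = +oo)%E)
  (Delta_sum_sqr : (\sum_(1 <= t <oo) (Delta t ^+ 2)%:E < +oo)%E)
  (Delta_ratio : forall c : nat,
     (ereal_sup [set (Delta t / Delta (t + c)%N)%:E | t in [set t | (1 <= t)%N]]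
       < +oo)%E)
  (v0 : 'I_n -> 'rV[R]_l) (v : nat -> 'I_n -> Omega -> 'rV[R]_l)
  (vP : learning_protocol mu E S Delta wm wo v0 v) :
  {ae P, forall omega, forall i : 'I_n,
    (fun t : nat => v t i omega) @ \oo --> mu}.
Proof.
have Ddiv := eseries_pinfty_unbounded Delta_ge0 Delta_sum.
have D0 := stepsize_gt0 Delta_ge0 Delta_nonincreasing Ddiv.
have Dsqr := series_sqr_cvg Delta_sum_sqr.
have Dcvg := sqr_cvg0 Delta_ge0 Dsqr.
have [rnoise mvm mvo indn] := noiseP.
pose h t : R := Delta t / 4.
have hsqr : cvgn (series (fun t => h t ^+ 2)).
  rewrite (_ : (fun t => _) = (16^-1 : R) *: (fun t => Delta t ^+ 2)); last first.
    by apply/funext => t; rewrite /h /= [RHS]mulrC; field.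
  exact: is_cvg_seriesZ.
pose smt i k w t : R := if `[< active_noise E S (inl (t, i)) >] then
  h t * wm t i w ord0 k else 0.
pose sobs i j k w t : R := if `[< active_noise E S (inr (t, i, j)) >] then
  h t * weight R (E t) i j * wo t i j w ord0 k else 0.
have cm i k : {ae P, forall w, cvgn (series (smt i k w))}.
  apply: (@ae_cvg_weighted_noise R l _ Omega P _ (active_noise E S) (noise wm wo)
    (fun t => inl (t, i)) (sigma ^+ 2) h k) => //.
  - by move=> t u [].
  - by move=> t; exact: mvm.
have co i j k : {ae P, forall w, cvgn (series (sobs i j k w))}.
  apply: (@ae_cvg_weighted_noise R l _ Omega P _ (active_noise E S) (noise wm wo)
    (fun t => inr (t, i, j)) (sigma' ^+ 2) (fun t => h t * weight R (E t) i j) k) => //.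
  - by move=> t u [].
  - by move=> t; exact: mvo.
  - apply: series_le_cvg hsqr => t; [exact: sqr_ge0|exact: sqr_ge0|].
    rewrite exprMn ler_piMr ?sqr_ge0// -[leRHS](expr1n _ 2).
    by rewrite ler_pXn2r ?nnegrE// ?weight_ge0// weight_le1.
have cmo : {ae P, forall w, forall i k,
    cvgn (series (smt i k w)) /\ forall j, cvgn (series (sobs i j k w))}.
  apply: filter_forall => i; apply: filter_forall => k.
  have : {ae P, forall w, forall j, cvgn (series (sobs i j k w))}.
    by apply: filter_forall => j.
  by move: (cm i k); apply: filterS2 => w.
(* From here on the sample point [w] is fixed, and one coordinate [k] is treated at a time. *)
move: cmo; apply: filterS => w cw i.
apply: cvg_mx_coord => i0 k; rewrite (ord1 i0).
pose x t i : R := v t i w ord0 k - mu ord0 k.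
pose e t i : R := smt i k w t + \sum_j sobs i j k w t.
suff : x ^~ i @ \oo --> (0 : R).
  have -> : (fun t => v t i w ord0 k) = cst (mu ord0 k) \+ x ^~ i.
    by apply/funext => t; rewrite /x /= addrC subrK.
  by move=> x0; rewrite -[X in _ --> X]addr0; apply: cvgD => //; exact: cvg_cst.
(* [W] steps contain a full [B]-window, and also [T] consecutive times, hence a measurement. *)
pose W := (B * T)%N.
have W0 : (0 < W)%N by rewrite muln_gt0 B_gt0.
have [g g0 gP] := stepsize_ratio D0 (Delta_ratio W).
have n0 : 0 < n%:R :> R by rewrite ltr0n; apply: leq_ltn_trans (ltn_ord i).
apply: (@consensus_cvg0 R n (fun t i => (i \in S t)%:R) (fun t => weight R (E t))
  _ h W n%:R^-1 g _ _ _ _ W0 g0 _ _ _ _ e x).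
- by move=> t; apply: weight_diffusive; have [] := E_simple t.
- by move=> t; rewrite divr_gt0.
- by move=> s t st; rewrite ler_pM2r ?invr_gt0// Delta_nonincreasing.
- rewrite -(mul0r (4^-1 : R)); exact: cvgMl.
- move=> A; have [N hN] := Ddiv (A * 4); exists N.
  by rewrite -mulr_suml ler_pdivlMr.
- by move=> t t0; rewrite mulrA ler_pM2r ?invr_gt0// gP.
- by rewrite invr_gt0.
(* Since [k' * W = k' * T * B], window [k'] begins with the [B]-window of index [k' * T]. *)
- move=> k' a b; have := E_connected (k' * T)%N a b.
  apply: connect_sub => {}a {}b /hasP[t tI Eab]; apply: connect1.
  apply/hasP; exists t; last exact: weight_ge_edge.
  move: tI; rewrite !mem_index_iota => /andP[t1 t2].
  have e1 : (k' * W = k' * T * B)%N by rewrite /W mulnA mulnAC.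
  rewrite e1 t1/=; apply: (leq_trans t2); rewrite addSn ltnS mulSnr leq_add2l.
  by rewrite leq_pmulr.
- move=> k'; have [t /andP[t1 t2] St] := measurement_within tauP tau0 tau_gap (ltn0Sn (k' * W)).
  have /set0Pn[j jS] := St; exists t; last by exists j; rewrite jS.
  by rewrite mem_index_iota t1 (leq_trans t2)// leq_add2l leq_pmull.
- move=> t j.
  have sobsE a : sobs j a k w t = h t * (weight R (E t) j a * wo t j a w ord0 k).
    rewrite /sobs /weight /=; case: asboolP; rewrite inE; first by rewrite mulrA.
    by move/negP/negbTE ->; rewrite mul0r mulr0.
  have consE : consensus_term E wo v t j w ord0 k =
      \sum_a weight R (E t) j a * (x t a - x t j + wo t j a w ord0 k).
    rewrite /consensus_term summxE big_mkcond/=; apply: eq_bigr => a _.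
    rewrite /weight inE; case: ifP => _; last by rewrite mul0r.
    by rewrite !mxE /x; congr (_ * _); ring.
  have split_sum : h t * (\sum_a weight R (E t) j a * (x t a - x t j + wo t j a w ord0 k)) =
      - h t * (\sum_a weight R (E t) j a * (x t j - x t a)) + \sum_a sobs j a k w t.
    rewrite !mulr_sumr -big_split/=; apply: eq_bigr => a _; rewrite sobsE; ring.
  have [_ vout vin] := vP.
  (* At a measuring node [mu + w - v] is [w - x], which gives the pin term of [diffusion]. *)
  rewrite /e /diffusion /smt; case: asboolP => /= jS.
    rewrite [in LHS]/x vin// /measurement !mxE consE -/(h t) split_sum jS /x/=; ring.
  have jS' : j \notin S t by exact/negP.
  by rewrite [in LHS]/x vout// !mxE consE -/(h t) split_sum (negbTE jS') /x/=; ring.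
- move=> j; rewrite /e; have [c1 c2] := cw j k.
  exact: (is_cvg_seriesD c1 (is_cvg_series_sum c2)).
Qed.
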